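(* Assume $W_c$ satisfies Assumption 2, let $r>0$, and suppose \[rH^{W_s}(M)+H^{W_c}(X|Z)<R<rH^{W_s}_0(M)+H^{W_c,\uparrow}_0(X|Z).\] Let $U^\uparrow:=U[W_s,W_c,\uparrow;r]$ and let $\theta_0\in(0,1)$ satisfy $(1-\theta_0)(U^\uparrow)'(\theta_0)+U^\uparrow(\theta_0)=R$. Then \[ \limsup_{n\to\infty}-\frac1n\log P_j(\lfloor rn\rfloor,n)\le\theta_0(U^\uparrow)'(\theta_0)-U^\uparrow(\theta_0)=\sup_{0\le\theta<1}\frac{\theta R-U^\uparrow(\theta)}{1-\theta}. \]
   Context: Setup. $\mathcal M$ finite, $W_s$ an irreducible aperiodic transition matrix on $\mathcal M$; message $M^k$ with law $P_{M_1}(m_1)\prod_{i=2}^kW_s(m_i|m_{i-1})$. $\mathcal X$ a finite abelian group, $\mathcal Z$ finite, $W_c=\{W_c(x,z|x',z')\}$ an irreducible aperiodic transition matrix on $\mathcal X\times\mathcal Z$; noise $(X^n,Z^n)$ with law $P_{X_1Z_1}(x_1,z_1)\prod_{i=2}^nW_c(x_i,z_i|x_{i-1},z_{i-1})$. Channel: input $\tilde x^n$ yields output $(x^n,z^n)$ with probability $P_{X^nZ^n}(x^n-\tilde x^n,z^n)$. $P_j(k,n)$ is the minimum over codes $(\mathsf e:\mathcal M^k\to\mathcal X^n,\ \mathsf d:(\mathcal X\times\mathcal Z)^n\to\mathcal M^k)$ of the average decoding error probability. $R:=\log|\mathcal X|$. Assumption 2: either (i) for every $\theta\in(-\infty,1)$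 and $z,z'$, $\sum_xW_c(x,z|x',z')^{1-\theta}$ does not depend on $x'$, or (ii) $|\mathcal Z|=1$; in either case $W_{c,Z}(z|z'):=\sum_xW_c(x,z|x',z')$ is independent of $x'$. Entrywise powers $a^t$ of transition probabilities are $0$ when $a=0$; $\lambda(A)$ denotes the Perron–Frobenius eigenvalue. $\theta H^{W_s}_{1-\theta}(M):=\log\lambda\big(W_s(m|m')^{1-\theta}\big)$. For transition matrices $V$ on $\mathcal Z$ with $V(z|z')>0$ whenever $W_{c,Z}(z|z')>0$: $H^{W_c|V}_{1-\theta}(X|Z):=\frac1\theta\log\lambda\big(W_c(x,z|x',z')^{1-\theta}V(z|z')^\theta\big)$, $H^{W_c,\uparrow}_{1-\theta}(X|Z):=\max_VH^{W_c|V}_{1-\theta}(X|Z)$, $H^{W_c,\downarrow}_{1-\theta}(X|Z):=H^{W_c|W_{c,Z}}_{1-\theta}(X|Z)$. $H^{W_s}(M)$, $H^{W_c}(X|Z)$ are the limits $\theta\to0$ of $H^{W_s}_{1-\theta}(M)$, $H^{W_c,\downarrow}_{1-\theta}(X|Z)$; $H^{W_s}_0(M)$, $H^{W_c,\uparrow}_0(X|Z)$ are the values at $\theta=1$. $U[W_s,W_c,\uparrow;r](\theta):=r\theta H^{W_s}_{1-\theta}(M)+\theta H^{W_c,\uparrow}_{1-\theta}(X|Z)$. *)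

(* Defs.v *)
From HB Require Import structures.
From mathcomp Require Import all_boot all_order all_algebra.
From Stdlib Require Import Reals ClassicalEpsilon.
Set Implicit Arguments. Unset Strict Implicit. Unset Printing Implicit Defensive.
Local Open Scope R_scope.

Definition sumR (T : finType) (F : T -> R) : R := \big[Rplus/R0]_(i : T) F i.

Definition Rsup (P : R -> Prop) : R := epsilon (inhabits R0) (fun l => is_lub P l).
Definition Rinf (P : R -> Prop) : R := - Rsup (fun x => P (- x)).

Definition lim0 (f : R -> R) : R :=
  epsilon (inhabits R0) (fun l => limit1_in f (fun t => t <> 0) l 0).

(* Probability vectors and transition matrices.  W i j = W(i|j). *)
Definition distr (T : finType) (P : T -> R) : Prop :=
  (forall i, 0 <= P i) /\ sumR P = 1.
Definition stochastic (T : finType) (W : T -> T -> R) : Prop :=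
  (forall i j, 0 <= W i j) /\ (forall j, sumR (fun i => W i j) = 1).

Fixpoint mpow (T : finType) (W : T -> T -> R) (k : nat) (i j : T) : R :=
  match k with
  | O => if i == j then 1 else 0
  | S k' => sumR (fun l => W i l * mpow W k' l j)
  end.

Definition irreducible (T : finType) (W : T -> T -> R) : Prop :=
  forall i j : T, exists k : nat, 0 < mpow W k i j.

Definition aperiodic (T : finType) (W : T -> T -> R) : Prop :=
  forall (i : T) (d : nat), leq 2 d ->
    exists k : nat, leq 1 k /\ 0 < mpow W k i i /\ ~~ dvdn d k.

Definition rpow (a t : R) : R := if Rlt_dec 0 a then Rpower a t else 0.

(* Perron–Frobenius eigenvalue: the eigenvalue admitting a (strictly)
   positive eigenvector (A i j is the (i,j) entry). *)
Definition PF (T : finType) (A : T -> T -> R) : R :=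
  epsilon (inhabits R0) (fun l => exists v : T -> R,
    (forall i, 0 < v i) /\ forall i, sumR (fun j => A i j * v j) = l * v i).

Fixpoint chain (T : Type) (W : T -> T -> R) (x : T) (s : seq T) : R :=
  match s with
  | [::] => 1
  | y :: s' => W y x * chain W y s'
  end.
Definition markov (T : Type) (P1 : T -> R) (W : T -> T -> R) (s : seq T) : R :=
  match s with
  | [::] => 1
  | x :: s' => P1 x * chain W x s'
  end.

(* noise sequence (x^n - xt^n, z^n) for output y = (x^n,z^n) and input xt *)
Definition noise_of (X : finZmodType) (Z : Type) (xt : seq X) (y : seq (X * Z))
  : seq (X * Z) :=
  [seq (GRing.add p.1.1 (GRing.opp p.2), p.1.2) | p <- zip y xt].

Definition err_prob (M : finType) (X : finZmodType) (Z : finType)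
  (PM1 : M -> R) (Ws : M -> M -> R) (PXZ1 : X * Z -> R) (Wc : X * Z -> X * Z -> R)
  (k n : nat) (e : {ffun k.-tuple M -> n.-tuple X})
  (d : {ffun n.-tuple (X * Z) -> k.-tuple M}) : R :=
  sumR (fun m : k.-tuple M => markov PM1 Ws m *
    sumR (fun y : n.-tuple (X * Z) =>
      markov PXZ1 Wc (noise_of (e m) y) * (if d y == m then 0 else 1))).

Definition Pj (M : finType) (X : finZmodType) (Z : finType)
  (PM1 : M -> R) (Ws : M -> M -> R) (PXZ1 : X * Z -> R) (Wc : X * Z -> X * Z -> R)
  (k n : nat) : R :=
  Rinf (fun p => exists (e : {ffun k.-tuple M -> n.-tuple X})
                        (d : {ffun n.-tuple (X * Z) -> k.-tuple M}),
                   p = err_prob PM1 Ws PXZ1 Wc e d).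

Definition WcZ (X : finZmodType) (Z : finType) (Wc : X * Z -> X * Z -> R)
  (z z' : Z) : R := sumR (fun x : X => Wc (x, z) (GRing.zero, z')).

Definition Assumption2 (X : finZmodType) (Z : finType) (Wc : X * Z -> X * Z -> R)
  : Prop :=
  (forall theta : R, theta < 1 -> forall (z z' : Z) (x1 x2 : X),
     sumR (fun x : X => rpow (Wc (x, z) (x1, z')) (1 - theta)) =
     sumR (fun x : X => rpow (Wc (x, z) (x2, z')) (1 - theta)))
  \/ #|Z| = S O.

Definition thetaHs (M : finType) (Ws : M -> M -> R) (theta : R) : R :=
  ln (PF (fun m m' => rpow (Ws m m') (1 - theta))).
Definition Hs (M : finType) (Ws : M -> M -> R) (theta : R) : R :=
  thetaHs Ws theta / theta.

Definition admissibleV (X : finZmodType) (Z : finType)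
  (Wc : X * Z -> X * Z -> R) (V : Z -> Z -> R) : Prop :=
  stochastic V /\ forall z z', 0 < WcZ Wc z z' -> 0 < V z z'.

Definition HcV (X : finZmodType) (Z : finType) (Wc : X * Z -> X * Z -> R)
  (V : Z -> Z -> R) (theta : R) : R :=
  / theta * ln (PF (fun y y' : X * Z =>
                     rpow (Wc y y') (1 - theta) * rpow (V y.2 y'.2) theta)).

Definition Hup (X : finZmodType) (Z : finType) (Wc : X * Z -> X * Z -> R)
  (theta : R) : R :=
  Rsup (fun h => exists V, admissibleV Wc V /\ h = HcV Wc V theta).
Definition Hdown (X : finZmodType) (Z : finType) (Wc : X * Z -> X * Z -> R)
  (theta : R) : R := HcV Wc (WcZ Wc) theta.

Definition H_s (M : finType) (Ws : M -> M -> R) : R := lim0 (Hs Ws).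
Definition H_c (X : finZmodType) (Z : finType) (Wc : X * Z -> X * Z -> R) : R :=
  lim0 (Hdown Wc).
Definition H0_s (M : finType) (Ws : M -> M -> R) : R := Hs Ws 1.
Definition H0_up (X : finZmodType) (Z : finType) (Wc : X * Z -> X * Z -> R) : R :=
  Hup Wc 1.

(* U[W_s,W_c,up;r](theta) = r theta H^{W_s}_{1-theta} + theta H^{up}_{1-theta};
   at theta = 0 the second term is its limiting value 0. *)
Definition Uup (M : finType) (X : finZmodType) (Z : finType)
  (Ws : M -> M -> R) (Wc : X * Z -> X * Z -> R) (r theta : R) : R :=
  r * thetaHs Ws theta + (if Req_EM_T theta 0 then 0 else theta * Hup Wc theta).

Definition floorR (x : R) : nat := Z.to_nat (Int_part x).

(* Main.v *)
Require Import Defs.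
From HB Require Import structures.
From mathcomp Require Import all_boot all_order all_algebra.
From Stdlib Require Import Reals Lra Lia ClassicalEpsilon FunctionalExtensionality.
Open Scope R_scope.

(* For an admissible V put U_V(t) = r log lambda(Ws^(1-t)) + log lambda(Wc^(1-t) V^t).
   Each U_V is convex by Hoelder's inequality and U is the supremum of the U_V, so the
   graph of U lies above its tangent at theta0, which evaluates the supremum.

   For the bound on the error probability, give a pair (message, noise) of probability P
   the weight P^(1-t) V(z)^t = exp(-(1-t) L) V(z), where L = log(V(z)/P); the total weight
   grows like exp(n U_V(t)).  Comparing the weights for t = theta0 and theta0 +- s (Chernoff)
   shows that L is about n U'(theta0) for most of the weight at theta0.  A channel output is
   decoded to a single message, so correctly decoded pairs have total V-mass at most
   |Z| |X|^n, hence weight about exp(n (R - (1-theta0) U'(theta0))) at most.  By the choice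
   of theta0 this is only comparable to the total weight exp(n U(theta0)).  To make it
   negligible, a small fraction beta of the steps, at the end, is tilted with t = 1 instead,
   where the weight is V itself on the support of P and U(1) > R yields the missing
   exponential factor.  The price in the exponent is of order beta. *)

(** * Finite sums of reals *)

(** These structures make the generic big-operator lemmas (splitting, distributivity, exchange)
    apply to [sumR]. *)
HB.instance Definition _ := Monoid.isComLaw.Build R R0 Rplus
  (fun x y z => esym (Rplus_assoc x y z)) Rplus_comm Rplus_0_l.
HB.instance Definition _ := Monoid.isMulLaw.Build R R0 Rmult Rmult_0_l Rmult_0_r.
HB.instance Definition _ := Monoid.isAddLaw.Build R Rmult Rplus
  Rmult_plus_distr_r Rmult_plus_distr_l.

Lemma eq_sumR {T : finType} (F G : T -> R) :
  (forall i, F i = G i) -> sumR F = sumR G.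
Proof. by move=> h; apply: eq_bigr => i _; apply: h. Qed.

Lemma sumRD {T : finType} (F G : T -> R) :
  sumR (fun i => F i + G i) = sumR F + sumR G.
Proof. exact: big_split. Qed.

Lemma sumR_mull {T : finType} (c : R) (F : T -> R) :
  sumR (fun i => c * F i) = c * sumR F.
Proof. by rewrite /sumR big_distrr. Qed.

Lemma sumR_mulr {T : finType} (c : R) (F : T -> R) :
  sumR (fun i => F i * c) = sumR F * c.
Proof. by rewrite /sumR big_distrl. Qed.

Lemma sumR_exchange {T1 T2 : finType} (F : T1 -> T2 -> R) :
  sumR (fun i => sumR (F i)) = sumR (fun j => sumR (fun i => F i j)).
Proof. exact: exchange_big. Qed.

Lemma sumR_le {T : finType} (F G : T -> R) :
  (forall i, F i <= G i) -> sumR F <= sumR G.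
Proof.
move=> h; rewrite /sumR; elim/big_ind2: _ => //; first lra.
by move=> *; lra.
Qed.

Lemma sumR0 (T : finType) : sumR (fun _ : T => 0) = 0.
Proof. exact: big1. Qed.

Lemma sumR_ge0 {T : finType} (F : T -> R) : (forall i, 0 <= F i) -> 0 <= sumR F.
Proof. by move=> h; rewrite -(sumR0 T); apply: sumR_le. Qed.

Lemma sumRB {T : finType} (F G : T -> R) :
  sumR (fun i => F i - G i) = sumR F - sumR G.
Proof.
rewrite (@eq_sumR _ _ (fun i => F i + -1 * G i)); last by move=> i; lra.
rewrite sumRD sumR_mull; lra.
Qed.

Lemma sumR_delta {T : finType} (x : T) (F : T -> R) :
  sumR (fun i => if i == x then F i else 0) = F x.
Proof. by rewrite /sumR -big_mkcond big_pred1_eq. Qed.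

Lemma sumR_term_le {T : finType} (F : T -> R) (x : T) :
  (forall i, 0 <= F i) -> F x <= sumR F.
Proof.
move=> h; rewrite -{1}(sumR_delta x F); apply: sumR_le => i.
by case: eqP => _; [lra | apply: h].
Qed.

Lemma sumR_gt0 {T : finType} (F : T -> R) (x : T) :
  (forall i, 0 <= F i) -> 0 < F x -> 0 < sumR F.
Proof. by move=> h hx; apply: Rlt_le_trans hx (sumR_term_le F x h). Qed.

Lemma sumR_gt0_ex {T : finType} (F : T -> R) :
  0 < sumR F -> exists i, 0 < F i.
Proof.
move=> h; case: (classic (exists i, 0 < F i)) => // hn; exfalso.
have : sumR F <= 0; last lra.
rewrite -(sumR0 T); apply: sumR_le => i.
by apply: Rnot_lt_le => hi; apply: hn; exists i.
Qed.

Lemma sumR_const (T : finType) (c : R) : sumR (fun _ : T => c) = INR #|T| * c.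
Proof.
rewrite /sumR big_const; elim: #|T| => [|n IH]; first by rewrite /=; lra.
by rewrite iterS IH S_INR; lra.
Qed.

Lemma sumR_pair {T1 T2 : finType} (F : T1 * T2 -> R) :
  sumR F = sumR (fun i => sumR (fun j => F (i, j))).
Proof.
by rewrite /sumR pair_big; apply: eq_bigr => -[i j] _.
Qed.

Lemma sumR_tuple0 {T : finType} (F : seq T -> R) :
  sumR (fun s : 0.-tuple T => F s) = F [::].
Proof.
rewrite -(sumR_delta [tuple] (fun s : 0.-tuple T => F s)).
by apply: eq_sumR => s; rewrite (tuple0 s) eqxx.
Qed.

Lemma sumR_tupleS {T : finType} (n : nat) (F : seq T -> R) :
  sumR (fun s : n.+1.-tuple T => F s) =
  sumR (fun x => sumR (fun s : n.-tuple T => F (x :: s))).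
Proof.
rewrite -(sumR_pair (fun p : T * n.-tuple T => F (p.1 :: p.2))) /sumR.
rewrite (reindex (fun p : T * n.-tuple T => [tuple of p.1 :: p.2])) //=.
exists (fun s : n.+1.-tuple T => (thead s, [tuple of behead s])).
  by move=> [x s] _; congr pair; apply: val_inj.
by move=> s _; rewrite [RHS]tuple_eta; apply: val_inj.
Qed.

Lemma finite_lower_bound {T : finType} (f : T -> R) :
  (forall i, 0 < f i) -> exists2 e, 0 < e & forall i, e <= f i.
Proof.
move=> hf.
suff [e he h] : exists2 e, 0 < e & forall i, i \in enum T -> e <= f i.
  by exists e => // i; apply: h; rewrite mem_enum.
elim: (enum T) => [|x s [e he IH]]; first by exists 1; [lra|].
exists (Rmin e (f x)); first by apply: Rmin_glb_lt.
move=> i; rewrite inE => /orP[/eqP->|/IH h]; first exact: Rmin_r.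
exact: Rle_trans (Rmin_l _ _) h.
Qed.

Lemma finite_upper_bound {T : finType} (f : T -> R) :
  exists2 C, 0 < C & forall i, f i <= C.
Proof.
exists (1 + sumR (fun i => Rabs (f i))).
  have := sumR_ge0 (fun i => Rabs (f i)) (fun i => Rabs_pos _); lra.
move=> i.
have := sumR_term_le (fun i => Rabs (f i)) i (fun i => Rabs_pos _).
by have := Rle_abs (f i); rewrite /=; lra.
Qed.

(** * Perron-Frobenius theorem for irreducible nonnegative matrices *)

Lemma inv_succ_lt (e : R) : 0 < e -> exists N : nat, forall n, leq N n -> / (INR n + 1) < e.
Proof.
move=> he; have [N hN] := INR_unbounded (/ e).
exists N => n /leP hn; have := le_INR _ _ hn => hn'.
have h0 := Rinv_0_lt_compat _ he.
rewrite -(Rinv_inv e); apply: Rinv_lt_contravar; last lra.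
by apply: Rmult_lt_0_compat; lra.
Qed.

(** A Bolzano-Weierstrass cluster point is approached within [1/(n+1)] at some index at least [n].
    The selection [phi] only has to dominate the identity: this is stable under composition and
    already preserves limits ([Un_cv_reindex]). *)
Lemma real_subsequence (u : nat -> R) (a b : R) :
  (forall n, a <= u n <= b) ->
  exists (phi : nat -> nat) (l : R), (forall n, leq n (phi n)) /\ Un_cv (fun n => u (phi n)) l.
Proof.
move=> hu; have [l hl] := Bolzano_Weierstrass u _ (compact_P3 a b) hu.
have h n : exists p, leq n p /\ Rabs (u p - l) < / (INR n + 1).
  have hpos : 0 < / (INR n + 1).
    by apply: Rinv_0_lt_compat; have := pos_INR n; lra.
  have [|p [hp1 hp2]] := hl (disc l (mkposreal _ hpos)) n.
    by exists (mkposreal _ hpos) => x.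
  by exists p; split => //; apply/leP.
pose phi n := proj1_sig (constructive_indefinite_description _ (h n)).
have hphi n : leq n (phi n) /\ Rabs (u (phi n) - l) < / (INR n + 1).
  exact: (proj2_sig (constructive_indefinite_description _ (h n))).
exists phi, l; split=> [n|e he]; first by case: (hphi n).
have [N hN] := inv_succ_lt e he.
exists N => n /leP /hN hn; rewrite /Rdist.
by case: (hphi n) => _; lra.
Qed.

Lemma Un_cv_reindex (u : nat -> R) (l : R) (phi : nat -> nat) :
  (forall n, leq n (phi n)) -> Un_cv u l -> Un_cv (fun n => u (phi n)) l.
Proof.
move=> hphi hu e he; have [N hN] := hu e he.
exists N => n /leP hn; apply: hN; apply/leP; exact: leq_trans hn (hphi n).
Qed.

(** Coordinates are treated one at a time along [enum T]; composing with a further selection keeps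
    the limits already obtained. *)
Lemma vector_subsequence {T : finType} (u : nat -> T -> R) (a b : R) :
  (forall n i, a <= u n i <= b) ->
  exists (phi : nat -> nat) (l : T -> R), (forall n, leq n (phi n)) /\
    forall i, Un_cv (fun n => u (phi n) i) (l i).
Proof.
move=> hu.
suff [phi [hphi h]] : exists phi : nat -> nat, (forall n, leq n (phi n)) /\
    forall i, i \in enum T -> exists l, Un_cv (fun n => u (phi n) i) l.
  have h' i : exists l, Un_cv (fun n => u (phi n) i) l by apply: h; rewrite mem_enum.
  exists phi, (fun i => proj1_sig (constructive_indefinite_description _ (h' i))).
  by split=> // i; apply: (proj2_sig (constructive_indefinite_description _ (h' i))).
elim: (enum T) => [|x s [phi [hphi IH]]]; first by exists (fun n => n).
have [psi [l [hpsi hl]]] := real_subsequence (fun n => u (phi n) x) a b (fun n => hu _ _).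
exists (fun n => phi (psi n)); split=> [n|i].
  exact: leq_trans (hpsi n) (hphi _).
rewrite inE => /orP[/eqP->|/IH [l' hl']]; first by exists l.
by exists l'; apply: (Un_cv_reindex (fun n => u (phi n) i)).
Qed.

Lemma Un_cv_const (c : R) : Un_cv (fun _ => c) c.
Proof. by move=> e he; exists O => n _; rewrite Rdist_eq. Qed.

Lemma Un_cv_sumR {T : finType} (u : nat -> T -> R) (l : T -> R) :
  (forall i, Un_cv (fun n => u n i) (l i)) ->
  Un_cv (fun n => sumR (u n)) (sumR l).
Proof.
move=> h; rewrite /sumR; elim: (index_enum T) => [|x s IH].
  rewrite big_nil; have -> : (fun n => \big[Rplus/0]_(i <- [::]) u n i) = fun _ => 0.
    by apply: functional_extensionality => n; rewrite big_nil.
  exact: Un_cv_const.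
rewrite big_cons.
have -> : (fun n => \big[Rplus/0]_(i <- x :: s) u n i) =
          fun n => u n x + \big[Rplus/0]_(i <- s) u n i.
  by apply: functional_extensionality => n; rewrite big_cons.
exact: CV_plus.
Qed.

Lemma Un_cv_le (u v : nat -> R) (lu lv : R) :
  (forall n, u n <= v n) -> Un_cv u lu -> Un_cv v lv -> lu <= lv.
Proof. by move=> h hu hv; apply: Rle_cv_lim hu hv. Qed.

(** * Matrix powers and irreducibility *)

Section Powers.
Context {T : finType} (A : T -> T -> R).
Hypothesis A_ge0 : forall i j, 0 <= A i j.

Lemma mpow_ge0 (k : nat) (i j : T) : 0 <= mpow A k i j.
Proof.
elim: k i j => [|k IH] i j /=; first by case: eqP => _; lra.
by apply: sumR_ge0 => l; apply: Rmult_le_pos.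
Qed.

Lemma mpowSr (k : nat) (i j : T) :
  mpow A k.+1 i j = sumR (fun l => mpow A k i l * A l j).
Proof.
elim: k i j => [|k IH] i j.
  rewrite /= (@eq_sumR _ _ (fun l => if l == j then A i j else 0)); last first.
    by move=> l; case: eqP => [->|_]; lra.
  rewrite (@eq_sumR _ (fun l => (if i == l then 1 else 0) * A l j)
     (fun l => if l == i then A i j else 0)); last first.
    by move=> l; rewrite eq_sym; case: eqP => [->|_]; lra.
  by rewrite !sumR_delta.
rewrite -[LHS]/(sumR (fun l => A i l * mpow A k.+1 l j)).
rewrite (@eq_sumR _ _ (fun l => sumR (fun l' => A i l * mpow A k l l' * A l' j))); last first.
  by move=> l; rewrite IH -sumR_mull; apply: eq_sumR => l'; lra.
rewrite sumR_exchange; apply: eq_sumR => l'.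
by rewrite sumR_mulr.
Qed.

End Powers.

Lemma mpow_transpose {T : finType} (A : T -> T -> R) (k : nat) (i j : T) :
  mpow (fun i j => A j i) k i j = mpow A k j i.
Proof.
elim: k i j => [|k IH] i j; first by rewrite /= eq_sym.
rewrite [RHS]mpowSr [LHS]/=; apply: eq_sumR => l; rewrite IH; lra.
Qed.

Lemma irreducible_transpose {T : finType} (A : T -> T -> R) :
  irreducible A -> irreducible (fun i j => A j i).
Proof. by move=> h i j; have [k hk] := h j i; exists k; rewrite mpow_transpose. Qed.

(** A positive entry of a power comes from a path of positive entries, and such a path survives in
    [B]. Irreducibility thus passes from [W] to its tilted matrices. *)
Lemma irreducible_support {T : finType} (A B : T -> T -> R) :
  (forall i j, 0 <= A i j) -> (forall i j, 0 <= B i j) ->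
  (forall i j, 0 < A i j -> 0 < B i j) -> irreducible A -> irreducible B.
Proof.
move=> hA hB hAB irr i j; have [k hk] := irr i j; exists k.
elim: k i j hk => [//|k IH] i j /= /sumR_gt0_ex [l hl].
apply: (sumR_gt0 _ l) => [l'|]; first by apply: Rmult_le_pos => //; apply: mpow_ge0.
have h1 := hA i l; have h2 := mpow_ge0 A hA k l j.
case: (Req_dec (A i l) 0) => h3; first by rewrite h3 in hl; lra.
case: (Req_dec (mpow A k l j) 0) => h4; first by rewrite h4 in hl; lra.
by apply: Rmult_lt_0_compat; [apply: hAB; lra|apply: IH; lra].
Qed.

Definition mulmv {T : finType} (A : T -> T -> R) (v : T -> R) (i : T) : R :=
  sumR (fun j => A i j * v j).

Lemma mulmv_lin {T : finType} (A : T -> T -> R) (c : R) (v w : T -> R) (i : T) :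
  mulmv A (fun j => v j - c * w j) i = mulmv A v i - c * mulmv A w i.
Proof.
rewrite /mulmv -sumR_mull -sumRB; apply: eq_sumR => j; lra.
Qed.

Lemma mulmvZ {T : finType} (A : T -> T -> R) (c : R) (v : T -> R) (i : T) :
  mulmv A (fun j => c * v j) i = c * mulmv A v i.
Proof. by rewrite /mulmv -sumR_mull; apply: eq_sumR => j; lra. Qed.

Lemma mulmv_comm {T : finType} (A B : T -> T -> R) (v : T -> R) (i : T) :
  (forall i j, sumR (fun l => A i l * B l j) = sumR (fun l => B i l * A l j)) ->
  mulmv A (mulmv B v) i = mulmv B (mulmv A v) i.
Proof.
have E C D : mulmv C (mulmv D v) i = sumR (fun j => sumR (fun l => C i l * D l j) * v j).
  rewrite /mulmv (@eq_sumR _ _ (fun l => sumR (fun j => C i l * D l j * v j))).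
    by rewrite sumR_exchange; apply: eq_sumR => j; rewrite sumR_mulr.
  by move=> l; rewrite -sumR_mull; apply: eq_sumR => j; lra.
by move=> h; rewrite !E; apply: eq_sumR => j; rewrite h.
Qed.

(** [B] is the sum of the powers [A^k] for [k <= N], with [N] the largest of the exponents
    witnessing irreducibility; a polynomial in [A] commutes with [A]. *)
Lemma irreducible_positive_commuting {T : finType} (A : T -> T -> R) :
  (forall i j, 0 <= A i j) -> irreducible A ->
  exists B : T -> T -> R, (forall i j, 0 < B i j) /\
   forall i j, sumR (fun l => A i l * B l j) = sumR (fun l => B i l * A l j).
Proof.
move=> hA irr.
have h (p : T * T) : exists k, 0 < mpow A k p.1 p.2 by apply: irr.
pose K p := proj1_sig (constructive_indefinite_description _ (h p)).
have hK p : 0 < mpow A (K p) p.1 p.2.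
  exact: (proj2_sig (constructive_indefinite_description _ (h p))).
pose N := \max_p K p.
exists (fun i j => sumR (fun k : 'I_N.+1 => mpow A k i j)); split=> i j.
  have hN : leq (K (i, j)).+1 N.+1 by rewrite ltnS; apply: leq_bigmax.
  by apply: (sumR_gt0 _ (Ordinal hN)) => [k|]; [apply: mpow_ge0|apply: (hK (i, j))].
rewrite (@eq_sumR _ _ (fun l => sumR (fun k : 'I_N.+1 => A i l * mpow A k l j))); last first.
  by move=> l; rewrite sumR_mull.
rewrite [RHS](@eq_sumR _ _ (fun l => sumR (fun k : 'I_N.+1 => mpow A k i l * A l j))); last first.
  by move=> l; rewrite sumR_mulr.
rewrite sumR_exchange [RHS]sumR_exchange; apply: eq_sumR => k.
by rewrite -mpowSr.
Qed.

(* The eigenvalue is the largest [t] with [t v <= A v] for some probability vector [v]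
   (Collatz-Wielandt); applying a positive matrix commuting with [A] to a
   maximizer makes it strictly positive and would make a defect strict. *)
Lemma perron_frobenius_exists {T : finType} (x0 : T) (A : T -> T -> R) :
  (forall i j, 0 <= A i j) -> irreducible A ->
  exists (l : R) (v : T -> R), (forall i, 0 < v i) /\ forall i, mulmv A v i = l * v i.
Proof.
move=> hA irr.
have [B [hB hAB]] := irreducible_positive_commuting A hA irr.
have comm v i := mulmv_comm A B v i hAB.
have Bpos v i : (forall j, 0 <= v j) -> (exists j, 0 < v j) -> 0 < mulmv B v i.
  move=> hv [j hj]; apply: (sumR_gt0 _ j) => [j'|].
    by apply: Rmult_le_pos => //; apply: Rlt_le.
  exact: Rmult_lt_0_compat.
pose E t := exists v : T -> R, distr v /\ forall i, t * v i <= mulmv A v i.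
have v_le1 (v : T -> R) : distr v -> forall i, v i <= 1.
  by move=> [h0 h1] i; rewrite -h1; apply: sumR_term_le.
have bE : bound E.
  exists (sumR (fun i => sumR (fun j => A i j))) => t [v [hv ht]].
  rewrite -(Rmult_1_r t); case: (hv) => hv0 <-; rewrite -sumR_mull.
  apply: sumR_le => i; apply: Rle_trans (ht i) _; apply: sumR_le => j.
  by have := hA i j; have := v_le1 v hv j; have := hv0 j; nra.
have nE : exists t, E t.
  exists 0, (fun i => if i == x0 then 1 else 0); split.
    split=> [i|]; first by case: eqP => _; lra.
    by rewrite (sumR_delta x0 (fun=> 1)).
  move=> i; rewrite Rmult_0_l; apply: sumR_ge0 => j.
  by have := hA i j; case: eqP => _; lra.
have [l [ubl lubl]] := completeness E bE nE.
have scaled t v : (forall i, 0 < v i) -> (forall i, t * v i <= mulmv A v i) -> E t.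
  move=> hv ht; have hs : 0 < sumR v by apply: (sumR_gt0 v x0) => // i; apply: Rlt_le.
  exists (fun i => / sumR v * v i); split.
    split=> [i|]; last by rewrite sumR_mull; field; lra.
    by apply: Rmult_le_pos; [apply/Rlt_le/Rinv_0_lt_compat|apply: Rlt_le].
  move=> i; rewrite mulmvZ; have := ht i; have := Rinv_0_lt_compat _ hs; nra.
(* Near-maximizers within [1/(n+1)] of the supremum [l]; their coordinates lie in [[0,1]], so
   compactness yields a maximizer. *)
have hseq n : exists v, distr v /\ forall i, (l - / (INR n + 1)) * v i <= mulmv A v i.
  have hpos : 0 < / (INR n + 1).
    by apply: Rinv_0_lt_compat; have := pos_INR n; lra.
  case: (classic (exists2 t, E t & l - / (INR n + 1) < t)) => [[t [v [hv ht]] hlt]|hn].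
    exists v; split=> // i; apply: Rle_trans (ht i).
    by case: hv => h0 _; have := h0 i; nra.
  exfalso; have : l <= l - / (INR n + 1); last lra.
  apply: lubl => t ht; apply: Rnot_lt_le => hlt; apply: hn; by exists t.
pose u n := proj1_sig (constructive_indefinite_description _ (hseq n)).
have hu n : distr (u n) /\ forall i, (l - / (INR n + 1)) * u n i <= mulmv A (u n) i.
  exact: (proj2_sig (constructive_indefinite_description _ (hseq n))).
have hu01 n i : 0 <= u n i <= 1.
  by case: (hu n) => hd _; split; [case: hd|apply: v_le1].
have [phi [v [hphi hv]]] := vector_subsequence u 0 1 hu01.
have v_ge0 i : 0 <= v i.
  by apply: (Un_cv_le (fun=> 0) _ 0 (v i) _ (Un_cv_const 0) (hv i)) => n; case: (hu01 (phi n) i).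
have v_sum : sumR v = 1.
  apply: UL_sequence (Un_cv_sumR _ _ hv) _.
  have -> : (fun n => sumR (u (phi n))) = fun=> 1; last exact: Un_cv_const.
  by apply: functional_extensionality => n; case: (hu (phi n)) => -[].
have v_sub i : l * v i <= mulmv A v i.
  have cA : Un_cv (fun n => mulmv A (u (phi n)) i) (mulmv A v i).
    by apply: Un_cv_sumR => j; apply: CV_mult => //; apply: Un_cv_const.
  have cl : Un_cv (fun n => (l - / (INR n + 1)) * u (phi n) i) ((l - 0) * v i).
    apply: CV_mult => //; apply: CV_minus; first exact: Un_cv_const.
    move=> e he; have [N hN] := inv_succ_lt e he; exists N => n /leP /hN.
    rewrite /Rdist Rminus_0_r Rabs_pos_eq //.
    by apply/Rlt_le/Rinv_0_lt_compat; have := pos_INR n; lra.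
  rewrite -(Rminus_0_r l); apply: (Un_cv_le _ _ _ _ _ cl cA) => n.
  case: (hu (phi n)) => _ /(_ i); have := hu01 (phi n) i => h1 h2.
  apply: Rle_trans h2; apply: Rmult_le_compat_r; first lra.
  have /leP /le_INR h3 := hphi n; have h4 := pos_INR n.
  have : / (INR (phi n) + 1) <= / (INR n + 1) by apply: Rinv_le_contravar; lra.
  lra.
have v_ex : exists j, 0 < v j by apply: sumR_gt0_ex; lra.
have w_pos i : 0 < mulmv B v i by apply: Bpos.
pose d i := mulmv A v i - l * v i.
have d_ge0 i : 0 <= d i by rewrite /d; have := v_sub i; lra.
have Bd i : mulmv B d i = mulmv A (mulmv B v) i - l * mulmv B v i.
  by rewrite /d mulmv_lin comm.
case: (classic (exists j, 0 < d j)) => hd.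
  have Bd_pos i : 0 < mulmv B d i by apply: Bpos.
  (* [e] is a positive lower bound of the ratios of [B d] to [B v], so [B v] would realize the value
     [l + e], beyond the supremum. *)
  have [e he hee] := finite_lower_bound (fun i => mulmv B d i / mulmv B v i)
    (fun i => Rdiv_lt_0_compat _ _ (Bd_pos i) (w_pos i)).
  exfalso; suff : l + e <= l by lra.
  apply: ubl; apply: (scaled _ (mulmv B v)) => // i.
  have h1 : e * mulmv B v i <= mulmv B d i.
    have := Rmult_le_compat_r (mulmv B v i) _ _ (Rlt_le _ _ (w_pos i)) (hee i).
    by rewrite /Rdiv Rmult_assoc Rinv_l ?Rmult_1_r //; have := w_pos i; lra.
  by rewrite Bd in h1; lra.
exists l, (mulmv B v); split=> // i.
have : mulmv B d i = 0; last by rewrite Bd; lra.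
rewrite -(sumR0 T); apply: eq_sumR => j.
have -> : d j = 0; last lra.
apply: Rle_antisym (d_ge0 j); apply: Rnot_lt_le => hj; apply: hd; by exists j.
Qed.

(** * Comparison with a left eigenvector *)

(** Pairing with [u] gives [l <u,w> = <uA,w> = <u,Aw> <= mu <u,w>], and [<u,w>] is positive. *)
Lemma left_eigen_le {T : finType} (x0 : T) (A : T -> T -> R) (l mu : R) (u w : T -> R) :
  (forall i, 0 < u i) -> (forall j, sumR (fun i => u i * A i j) = l * u j) ->
  (forall i, 0 < w i) -> (forall i, mulmv A w i <= mu * w i) -> l <= mu.
Proof.
move=> hu hA hw hAw.
have hs : 0 < sumR (fun i => u i * w i).
  apply: (sumR_gt0 _ x0) => [i|]; last exact: Rmult_lt_0_compat.
  by apply/Rlt_le/Rmult_lt_0_compat.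
apply: (Rmult_le_reg_r _ _ _ hs); rewrite -!sumR_mull.
rewrite (@eq_sumR _ _ (fun j => sumR (fun i => u i * A i j * w j))); last first.
  by move=> j; rewrite sumR_mulr hA; lra.
rewrite sumR_exchange; apply: sumR_le => i.
rewrite (@eq_sumR _ _ (fun j => u i * (A i j * w j))); last by move=> j; lra.
rewrite sumR_mull; have := hAw i; rewrite /mulmv; have := hu i; nra.
Qed.

Lemma left_eigen_ge {T : finType} (x0 : T) (A : T -> T -> R) (l mu : R) (u w : T -> R) :
  (forall i, 0 < u i) -> (forall j, sumR (fun i => u i * A i j) = l * u j) ->
  (forall i, 0 < w i) -> (forall i, mu * w i <= mulmv A w i) -> mu <= l.
Proof.
move=> hu hA hw hAw.
have := left_eigen_le x0 (fun i j => - A i j) (- l) (- mu) u w hu _ hw.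
case=> [j|i| |]; [|rewrite /mulmv|lra|lra].
  rewrite (@eq_sumR _ _ (fun i => -1 * (u i * A i j))); last by move=> i; lra.
  by rewrite sumR_mull hA; lra.
rewrite (@eq_sumR _ _ (fun j => -1 * (A i j * w j))); last by move=> j; lra.
by rewrite sumR_mull; have := hAw i; rewrite /mulmv; lra.
Qed.

(** [PF] is chosen by [epsilon], so an eigenvalue with a positive right eigenvector must exist
    first. The transpose supplies a left eigenvector, and the two comparisons force its eigenvalue
    to equal [PF A]. *)
Lemma PF_eigenvectors {T : finType} (x0 : T) (A : T -> T -> R) :
  (forall i j, 0 <= A i j) -> irreducible A ->
  exists u v : T -> R,
    [/\ forall i, 0 < u i, forall j, sumR (fun i => u i * A i j) = PF A * u j,
        forall i, 0 < v i & forall i, mulmv A v i = PF A * v i].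
Proof.
move=> hA irr.
have hex : exists l, exists v : T -> R, (forall i, 0 < v i) /\
    forall i, sumR (fun j => A i j * v j) = l * v i.
  exact: perron_frobenius_exists.
have [v [hv hAv]] := epsilon_spec (inhabits R0) _ hex.
have [l [u [hu huA]]] := perron_frobenius_exists x0 (fun i j => A j i)
  (fun i j => hA j i) (irreducible_transpose A irr).
have huA' j : sumR (fun i => u i * A i j) = l * u j.
  by rewrite -huA; apply: eq_sumR => i; lra.
have El : l = PF A.
  apply: Rle_antisym.
    by apply: (left_eigen_le x0 A l (PF A) u v) => // i; rewrite [mulmv _ _ _]hAv; apply: Rle_refl.
  by apply: (left_eigen_ge x0 A l (PF A) u v) => // i; rewrite [mulmv _ _ _]hAv; apply: Rle_refl.
by exists u, v; split=> //; rewrite -El.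
Qed.

(** * Tilted transition matrices and weights of paths *)

(** The tangent bound [exp y >= 1 + y] at the mean [c]; the first-order terms cancel on
    averaging. *)
Lemma exp_convex (p a b : R) : 0 <= p <= 1 ->
  exp ((1 - p) * a + p * b) <= (1 - p) * exp a + p * exp b.
Proof.
move=> hp; set c := (1 - p) * a + p * b.
have ha := exp_ineq1_le (a - c); have hb := exp_ineq1_le (b - c).
have Ea : exp a = exp c * exp (a - c) by rewrite -exp_plus; congr exp; lra.
have Eb : exp b = exp c * exp (b - c) by rewrite -exp_plus; congr exp; lra.
have hc := exp_pos c.
have -> : exp c = exp c * ((1 - p) * (1 + (a - c)) + p * (1 + (b - c))).
  rewrite -[LHS]Rmult_1_r; congr Rmult; rewrite /c; ring.
rewrite Ea Eb.
have -> : (1 - p) * (exp c * exp (a - c)) + p * (exp c * exp (b - c)) =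
  exp c * ((1 - p) * exp (a - c) + p * exp (b - c)) by ring.
apply: Rmult_le_compat_l; first lra.
by apply: Rplus_le_compat; apply: Rmult_le_compat_l; lra.
Qed.

Lemma ln_le_compat (x y : R) : 0 < x -> x <= y -> ln x <= ln y.
Proof. by move=> h [h'|->]; [apply/Rlt_le/ln_increasing|apply: Rle_refl]. Qed.

Lemma exp_le_compat (x y : R) : x <= y -> exp x <= exp y.
Proof. by move=> [h|->]; [apply/Rlt_le/exp_increasing|apply: Rle_refl]. Qed.

Lemma exp_le_inv (x y : R) : exp x <= exp y -> x <= y.
Proof. by move=> h; apply: Rnot_lt_le => /exp_increasing; lra. Qed.

Lemma rpow_pos (a t : R) : 0 < a -> rpow a t = exp (t * ln a).
Proof. by rewrite /rpow /Rpower; case: Rlt_dec. Qed.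

Lemma rpow_npos (a t : R) : ~ 0 < a -> rpow a t = 0.
Proof. by rewrite /rpow; case: Rlt_dec. Qed.

Lemma rpow_ge0 (a t : R) : 0 <= rpow a t.
Proof.
case: (Rlt_dec 0 a) => h; first by rewrite rpow_pos //; apply/Rlt_le/exp_pos.
rewrite rpow_npos //; lra.
Qed.

Lemma rpow_le1 (a t : R) : a <= 1 -> 0 <= t -> rpow a t <= 1.
Proof.
move=> ha ht; case: (Rlt_dec 0 a) => h; last by rewrite rpow_npos //; lra.
rewrite rpow_pos // -exp_0; apply: exp_le_compat.
by have := ln_le_compat a 1 h ha; rewrite ln_1; nra.
Qed.

(** Common form of both tilted matrices: [V = 1] for the source, a lifted [V] for the noise. Since
    [rpow] vanishes at 0 for every exponent, the entry at [t = 1] is [V] restricted to the support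
    of [W]. *)
Definition tilt {T : Type} (W V : T -> T -> R) (t : R) (i j : T) : R :=
  rpow (W i j) (1 - t) * rpow (V i j) t.
Arguments tilt : simpl never.

Definition lam {T : finType} (W V : T -> T -> R) (t : R) : R := ln (PF (tilt W V t)).

Lemma thetaHs_lam {T : finType} (W : T -> T -> R) (t : R) :
  thetaHs W t = lam W (fun _ _ => 1) t.
Proof.
rewrite /thetaHs /lam; congr (ln (PF _)).
apply: functional_extensionality => i; apply: functional_extensionality => j.
by rewrite /tilt [rpow 1 t]rpow_pos ?ln_1 ?Rmult_0_r ?exp_0 ?Rmult_1_r //; lra.
Qed.

(** * Logarithm of the tilted Perron-Frobenius eigenvalue *)

Section Tilt.
Context {T : finType} (x0 : T) (W V : T -> T -> R).
Hypothesis stW : stochastic W.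
Hypothesis irrW : irreducible W.
Hypothesis WV : forall i j, 0 < W i j -> 0 < V i j.
Hypothesis V_le1 : forall i j, V i j <= 1.

Lemma stochastic_le1 (i j : T) : W i j <= 1.
Proof.
case: stW => h0 h1; rewrite -(h1 j).
by apply: (sumR_term_le (fun i => W i j)) => k.
Qed.

Lemma tilt_ge0 (t : R) (i j : T) : 0 <= tilt W V t i j.
Proof. by apply: Rmult_le_pos; apply: rpow_ge0. Qed.

Lemma tilt_pos (t : R) (i j : T) : 0 < W i j ->
  tilt W V t i j = exp ((1 - t) * ln (W i j) + t * ln (V i j)).
Proof. by move=> h; rewrite /tilt !rpow_pos ?exp_plus //; apply: WV. Qed.

Lemma tilt_eq0 (t : R) (i j : T) : ~ 0 < W i j -> tilt W V t i j = 0.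
Proof. by move=> h; rewrite /tilt rpow_npos // Rmult_0_l. Qed.

Lemma tilt_irreducible (t : R) : irreducible (tilt W V t).
Proof.
apply: (irreducible_support W) => //; first by case: stW.
  exact: tilt_ge0.
by move=> i j h; rewrite tilt_pos //; apply: exp_pos.
Qed.

Lemma tilt_eigenvectors (t : R) : exists u v : T -> R,
    [/\ forall i, 0 < u i, forall j, sumR (fun i => u i * tilt W V t i j) = exp (lam W V t) * u j,
        forall i, 0 < v i & forall i, mulmv (tilt W V t) v i = exp (lam W V t) * v i].
Proof.
have [u [v [hu huA hv hAv]]] := PF_eigenvectors x0 _ (tilt_ge0 t) (tilt_irreducible t).
exists u, v; suff h : 0 < PF (tilt W V t) by rewrite /lam exp_ln.
have [i hi] : exists i, 0 < W i x0 by apply: sumR_gt0_ex; case: stW => _ ->; lra.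
have h : 0 < PF (tilt W V t) * u x0.
  rewrite -huA; apply: (sumR_gt0 _ i) => [k|].
    by apply: Rmult_le_pos; [apply: Rlt_le|apply: tilt_ge0].
  by apply: Rmult_lt_0_compat => //; rewrite tilt_pos //; apply: exp_pos.
by have := hu x0; nra.
Qed.

Lemma lam_le_of_subinvariant (t mu : R) (w : T -> R) : (forall i, 0 < w i) ->
  (forall i, mulmv (tilt W V t) w i <= exp mu * w i) -> lam W V t <= mu.
Proof.
move=> hw h; have [u [v [hu huA _ _]]] := tilt_eigenvectors t.
by apply: exp_le_inv; apply: (left_eigen_le x0 _ _ _ u w hu huA hw).
Qed.

(* Hoelder's inequality applied to the weighted geometric mean of the two eigenvectors. *)
Lemma lam_convex (p t0 t1 : R) : 0 <= p <= 1 ->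
  lam W V ((1 - p) * t0 + p * t1) <= (1 - p) * lam W V t0 + p * lam W V t1.
Proof.
move=> hp.
have [_ [v0 [_ _ hv0 hA0]]] := tilt_eigenvectors t0.
have [_ [v1 [_ _ hv1 hA1]]] := tilt_eigenvectors t1.
pose w i := exp ((1 - p) * ln (v0 i) + p * ln (v1 i)).
apply: (lam_le_of_subinvariant _ _ w) => i; first exact: exp_pos.
set mu := (1 - p) * lam W V t0 + p * lam W V t1.
(* Divided by the eigenvalue, the terms of row [i] form a probability vector ([sx]); convexity of
   [exp] bounds the mixed terms by a convex combination of two such vectors. *)
pose x t v j := tilt W V t i j * v j * / (exp (lam W V t) * v i).
have sx t v : 0 < v i -> mulmv (tilt W V t) v i = exp (lam W V t) * v i -> sumR (x t v) = 1.
  move=> hv hA; rewrite sumR_mulr [X in X * _]hA Rinv_r //.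
  by have := exp_pos (lam W V t); have := hv; nra.
have x_ge0 t v j : (forall i, 0 < v i) -> 0 <= x t v j.
  move=> hv; apply: Rmult_le_pos; first by apply: Rmult_le_pos; [apply: tilt_ge0|apply: Rlt_le].
  by apply/Rlt_le/Rinv_0_lt_compat/Rmult_lt_0_compat => //; apply: exp_pos.
have xE t v j : (forall i, 0 < v i) -> 0 < W i j ->
  x t v j = exp ((1 - t) * ln (W i j) + t * ln (V i j) + ln (v j) - lam W V t - ln (v i)).
  move=> hv hW; rewrite /x tilt_pos // /Rminus !exp_plus !exp_Ropp (exp_ln (v j)) // (exp_ln (v i)) //.
  by have := hv i; have := exp_pos (lam W V t) => *; field; lra.
apply: Rle_trans (_ : sumR (fun j => exp mu * w i * ((1 - p) * x t0 v0 j + p * x t1 v1 j)) <= _).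
  apply: sumR_le => j; case: (Rlt_dec 0 (W i j)) => hW; last first.
    rewrite tilt_eq0 // Rmult_0_l; apply: Rmult_le_pos.
      by apply: Rmult_le_pos; apply/Rlt_le/exp_pos.
    by have := x_ge0 t0 v0 j hv0; have := x_ge0 t1 v1 j hv1; nra.
  rewrite !xE // tilt_pos // /w -!exp_plus.
  apply: Rle_trans (Rmult_le_compat_l _ _ _ _ (exp_convex p _ _ hp)); last exact/Rlt_le/exp_pos.
  rewrite -exp_plus; apply: exp_le_compat; rewrite /mu; apply: Req_le; ring.
rewrite sumR_mull sumRD !sumR_mull !sx //; apply: Req_le; ring.
Qed.

(** The constant vector is a test vector: entries are at most 1, so row sums are at most [#|T|]. The
    bound is uniform in [V], which makes the supremum over [V] finite. *)
Lemma lam_le_card (t : R) : 0 <= t <= 1 -> lam W V t <= ln (INR #|T|).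
Proof.
move=> ht; apply: (lam_le_of_subinvariant _ _ (fun=> 1)) => [_|i]; first lra.
have hT : 0 < INR #|T| by apply: lt_0_INR; apply/ltP/card_gt0P; exists x0.
rewrite exp_ln // -sumR_const; apply: sumR_le => j; rewrite Rmult_1_r.
rewrite -(Rmult_1_r 1); apply: Rmult_le_compat; try exact: rpow_ge0.
  by apply: rpow_le1; [apply: stochastic_le1|lra].
by apply: rpow_le1 => //; lra.
Qed.

(** At [t = 0] the tilted matrix is [W], whose columns sum to 1; summing the eigenvector equation
    over [i] leaves the eigenvalue 1. *)
Lemma lam0 : lam W V 0 = 0.
Proof.
have [_ [v [_ _ hv hA]]] := tilt_eigenvectors 0.
have E : sumR v = exp (lam W V 0) * sumR v.
  rewrite -sumR_mull -(eq_sumR _ _ hA) /mulmv sumR_exchange; apply: eq_sumR => j.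
  rewrite sumR_mulr; case: stW => h0 h1.
  rewrite (@eq_sumR _ _ (fun i => W i j)) ?h1 ?Rmult_1_l // => i.
  case: (Rlt_dec 0 (W i j)) => hW.
    by rewrite tilt_pos // Rmult_0_l Rplus_0_r Rminus_0_r Rmult_1_l exp_ln.
  by rewrite tilt_eq0 //; have := h0 i j; lra.
have hs : 0 < sumR v by apply: (sumR_gt0 v x0) => // i; apply: Rlt_le.
apply: exp_inv; rewrite exp_0; nra.
Qed.

End Tilt.

(** * Path weights with two successive matrices *)

Fixpoint pchain {T : Type} (A1 A2 : T -> T -> R) (n1 : nat) (x : T) (s : seq T) : R :=
  match s, n1 with
  | [::], _ => 1
  | y :: s', O => A2 y x * pchain A1 A2 O y s'
  | y :: s', S n => A1 y x * pchain A1 A2 n y s'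
  end.

Lemma pchain_ge0 {T : Type} (A1 A2 : T -> T -> R) (n1 : nat) (x : T) (s : seq T) :
  (forall i j, 0 <= A1 i j) -> (forall i j, 0 <= A2 i j) -> 0 <= pchain A1 A2 n1 x s.
Proof.
move=> h1 h2; elim: s n1 x => [|y s IH] [|n1] x /=; try lra;
by apply: Rmult_le_pos.
Qed.

(** By induction [H n] stays between multiples of [exp (n L) u]; replacing [u] by its extreme values
    costs [K]. As [K] precedes [H], [c] and [c'], the lemma can be chained over two phases. *)
Lemma recursion_bounds {T : finType} (A : T -> T -> R) (L : R) (u : T -> R) :
  (forall i j, 0 <= A i j) -> (forall i, 0 < u i) ->
  (forall j, sumR (fun i => u i * A i j) = exp L * u j) ->
  exists K, forall (H : nat -> T -> R) (c c' : R),
    (forall n x, H n.+1 x = sumR (fun y => A y x * H n y)) ->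
    (forall x, exp c <= H O x <= exp c') ->
    forall n x, exp (c + INR n * L - K) <= H n x <= exp (c' + INR n * L + K).
Proof.
move=> hA hu huA.
have [m hm hmu] := finite_lower_bound u hu.
have [M hM hMu] := finite_upper_bound u.
exists (ln M - ln m) => H c c' rec h0 n x.
have Estep k : exp (INR k.+1 * L) = exp (INR k * L) * exp L.
  by rewrite -exp_plus S_INR; congr exp; ring.
have lower y : exp c * exp (INR n * L) * u y <= M * H n y.
  elim: n y => [|n IH] y.
    by rewrite Rmult_0_l exp_0 Rmult_1_r; have := hMu y; have := h0 y; have := hu y; have := exp_pos c; nra.
  rewrite rec -sumR_mull.
  rewrite Estep -Rmult_assoc Rmult_assoc -huA -sumR_mull; apply: sumR_le => z.
  by have := IH z; have := hA z y; nra.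
have upper y : m * H n y <= exp c' * exp (INR n * L) * u y.
  elim: n y {lower} => [|n IH] y.
    by rewrite Rmult_0_l exp_0 Rmult_1_r; have := hmu y; have := h0 y; have := hu y; have := exp_pos c; nra.
  rewrite rec -sumR_mull.
  rewrite Estep -Rmult_assoc Rmult_assoc -huA -sumR_mull; apply: sumR_le => z.
  by have := IH z; have := hA z y; nra.
have e1 := exp_pos (c + INR n * L); have e2 := exp_pos (c' + INR n * L).
split.
  have -> : c + INR n * L - (ln M - ln m) = c + INR n * L + ln m + - ln M by ring.
  rewrite !exp_plus exp_Ropp !exp_ln //.
  have := lower x; have := hmu x; have := exp_pos c; have := exp_pos (INR n * L) => a b d e.
  apply: (Rmult_le_reg_l M) => //.
  have -> : M * (exp c * exp (INR n * L) * m * / M) = exp c * exp (INR n * L) * m by field; lra.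
  apply: Rle_trans e; apply: Rmult_le_compat_l => //.
  by apply/Rlt_le/Rmult_lt_0_compat.
have -> : c' + INR n * L + (ln M - ln m) = c' + INR n * L + ln M + - ln m by ring.
rewrite !exp_plus exp_Ropp !exp_ln //.
have := upper x; have := hMu x; have := exp_pos c'; have := exp_pos (INR n * L) => a b d e.
apply: (Rmult_le_reg_l m) => //.
have -> : m * (exp c' * exp (INR n * L) * M * / m) = exp c' * exp (INR n * L) * M by field; lra.
apply: Rle_trans e _; apply: Rmult_le_compat_l => //.
by apply/Rlt_le/Rmult_lt_0_compat.
Qed.

(** The recursion runs backwards along the path: the total over the last [n2] steps is the initial
    value for the first [n1] steps. *)
Lemma sumR_pchain_bounds {T : finType} (A1 A2 : T -> T -> R) (L1 L2 : R) (u1 u2 : T -> R) :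
  (forall i j, 0 <= A1 i j) -> (forall i, 0 < u1 i) ->
  (forall j, sumR (fun i => u1 i * A1 i j) = exp L1 * u1 j) ->
  (forall i j, 0 <= A2 i j) -> (forall i, 0 < u2 i) ->
  (forall j, sumR (fun i => u2 i * A2 i j) = exp L2 * u2 j) ->
  exists K, forall n1 n2 x,
    exp (INR n1 * L1 + INR n2 * L2 - K) <=
    sumR (fun s : (addn n1 n2).-tuple T => pchain A1 A2 n1 x s)
    <= exp (INR n1 * L1 + INR n2 * L2 + K).
Proof.
move=> hA1 hu1 E1 hA2 hu2 E2.
have [K1 h1] := recursion_bounds A1 L1 u1 hA1 hu1 E1.
have [K2 h2] := recursion_bounds A2 L2 u2 hA2 hu2 E2.
exists (K1 + K2) => n1 n2 x.
pose H2 n x := sumR (fun s : n.-tuple T => pchain A1 A2 O x s).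
have b2 y : exp (0 + INR n2 * L2 - K2) <= H2 n2 y <= exp (0 + INR n2 * L2 + K2).
  apply: h2 => [n z|z].
    rewrite /H2 sumR_tupleS; apply: eq_sumR => w.
    by rewrite -sumR_mull.
  rewrite /H2 exp_0 (@sumR_tuple0 T (fun s => pchain A1 A2 O z s)) /=; lra.
pose H1 n x := sumR (fun s : (addn n n2).-tuple T => pchain A1 A2 n x s).
have rec1 n z : H1 n.+1 z = sumR (fun y => A1 y z * H1 n y).
  rewrite /H1 sumR_tupleS; apply: eq_sumR => w.
  by rewrite -sumR_mull.
have [l r] := h1 H1 _ _ rec1 b2 n1 x.
split.
  by apply: Rle_trans l; apply: exp_le_compat; lra.
by apply: Rle_trans r _; apply: exp_le_compat; lra.
Qed.

Lemma sumR_pchain_const {T : finType} (A1 A2 : T -> T -> R) (c : R) (n n1 : nat) (x : T) :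
  (forall j, sumR (fun i => A1 i j) = c) -> (forall j, sumR (fun i => A2 i j) = c) ->
  sumR (fun s : n.-tuple T => pchain A1 A2 n1 x s) = c ^ n.
Proof.
move=> h1 h2; elim: n n1 x => [|n IH] n1 x.
  by rewrite (@sumR_tuple0 T (fun s => pchain A1 A2 n1 x s)); case: n1.
rewrite sumR_tupleS; case: n1 => [|n1] /=.
  rewrite (@eq_sumR _ _ (fun y => A2 y x * c ^ n)) => [|y]; first by rewrite sumR_mulr h2.
  by rewrite sumR_mull IH.
rewrite (@eq_sumR _ _ (fun y => A1 y x * c ^ n)) => [|y]; first by rewrite sumR_mulr h1.
by rewrite sumR_mull IH.
Qed.

(* [L] is the log-likelihood ratio of [V1] to [W] along the first [n1] steps. *)
Lemma pchain_tilt {T : finType} (W V1 V2 : T -> T -> R) (c : R) (n1 : nat) (x : T) (s : seq T) :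
  (forall i j, 0 <= W i j) -> 0 <= c ->
  (forall i j, 0 < W i j -> 0 < V1 i j) -> (forall i j, 0 < W i j -> 0 < V2 i j <= 1) ->
  (forall i j, 0 < W i j -> c <= W i j) ->
  (chain W x s = 0 /\ forall t, pchain (tilt W V1 t) (tilt W V2 1) n1 x s = 0) \/
  exists L, [/\ 0 < chain W x s, 0 < pchain V1 V2 n1 x s,
    c ^ (subn (size s) n1) * exp (- L) * pchain V1 V2 n1 x s <= chain W x s &
    forall t, pchain (tilt W V1 t) (tilt W V2 1) n1 x s =
              exp (- (1 - t) * L) * pchain V1 V2 n1 x s].
Proof.
move=> hW hc hV1 hV2 hcW; elim: s n1 x => [|y s IH] n1 x.
  have E A1 A2 : pchain A1 A2 n1 x [::] = 1 by case: n1.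
  right; exists 0; rewrite !E sub0n Ropp_0 exp_0 /=.
  by split=> [|||t]; try lra; rewrite ?E Rmult_0_r exp_0; lra.
case: (Rlt_dec 0 (W y x)) => hyx; last first.
  left; split=> [|t]; first by rewrite /= (Rle_antisym _ _ (Rnot_lt_le _ _ hyx) (hW y x)) Rmult_0_l.
  by case: n1 => [|n1] /=; rewrite tilt_eq0 // Rmult_0_l.
case: n1 => [|n1].
  case: (IH O y) => [[h1 h2]|[L [h1 h2 h3 h4]]].
    by left; split=> [|t] /=; rewrite ?h1 ?h2 Rmult_0_r.
  have [v0 v1] := hV2 _ _ hyx.
  (* In the second phase [W >= c >= c * V2], so a step leaves [L] unchanged and costs one factor
     [c]. *)
  right; exists L; split=> [|||t] /=; try exact: Rmult_lt_0_compat.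
    rewrite subn0 in h3; have h5 := hcW _ _ hyx.
    have h6 : 0 <= c ^ size s * exp (- L) * pchain V1 V2 0 y s.
      apply: Rmult_le_pos; last exact: Rlt_le.
      by apply: Rmult_le_pos; [apply: pow_le|apply/Rlt_le/exp_pos].
    apply: Rle_trans (_ : W y x * (c ^ size s * exp (- L) * pchain V1 V2 0 y s) <= _); last first.
      by apply: Rmult_le_compat_l => //; lra.
    rewrite (_ : _ * (V2 y x * _) = c * V2 y x * (c ^ size s * exp (- L) * pchain V1 V2 0 y s)).
      by apply: Rmult_le_compat_r => //; nra.
    ring.
  rewrite h4 tilt_pos //; last by move=> i j /hV2 [].
  rewrite (_ : (1 - 1) * _ + 1 * _ = ln (V2 y x)); last ring.
  by rewrite exp_ln //; ring.
case: (IH n1 y) => [[h1 h2]|[L [h1 h2 h3 h4]]].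
  by left; split=> [|t] /=; rewrite ?h1 ?h2 Rmult_0_r.
have v0 := hV1 _ _ hyx.
right; exists (ln (V1 y x) - ln (W y x) + L); split=> [|||t]; try exact: Rmult_lt_0_compat.
  have -> : - (ln (V1 y x) - ln (W y x) + L) = ln (W y x) + - ln (V1 y x) + - L by ring.
  rewrite !exp_plus exp_Ropp !exp_ln //= subSS.
  rewrite (_ : _ * (V1 y x * _) = W y x * (c ^ subn (size s) n1 * exp (- L) * pchain V1 V2 n1 y s)).
    by apply: Rmult_le_compat_l => //; lra.
  field; lra.
rewrite /= h4 tilt_pos //.
have -> : - (1 - t) * (ln (V1 y x) - ln (W y x) + L) =
  ((1 - t) * ln (W y x) + t * ln (V1 y x)) + - (ln (V1 y x)) + - (1 - t) * L by ring.
rewrite (exp_plus _ (- (1 - t) * L)) (exp_plus _ (- _)) exp_Ropp exp_ln //.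
field; lra.
Qed.

(** * Lower bound on the error probability of a code *)

(** If [L <= b], the first term of the bracket suffices; if [L > b], the bracket is nonpositive
    because [exp (s * (L - b)) >= 1]. It turns weight at [th] into probability, up to an upper
    tail. *)
Lemma tilt_upper_tail (th s b L : R) : 0 <= th -> 0 <= s ->
  exp (- th * b) * (exp (- (1 - th) * L) - exp (- s * b) * exp (- (1 - (th + s)) * L))
  <= exp (- L).
Proof.
move=> hth hs.
have e0 := exp_pos (- th * b); have e2 := exp_pos (- s * b).
have e3 := exp_pos (- (1 - (th + s)) * L).
case: (Rle_lt_dec L b) => h.
  apply: Rle_trans (_ : exp (- th * b) * exp (- (1 - th) * L) <= _).
    by apply: Rmult_le_compat_l; have := Rmult_lt_0_compat _ _ e2 e3; lra.
  by rewrite -exp_plus; apply: exp_le_compat; nra.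
have : exp (- (1 - th) * L) <= exp (- s * b) * exp (- (1 - (th + s)) * L).
  by rewrite -exp_plus; apply: exp_le_compat; nra.
move=> h'; apply: Rle_trans (_ : exp (- th * b) * 0 <= _); last by have := exp_pos (- L); lra.
by apply: Rmult_le_compat_l; lra.
Qed.

(** The first term dominates when [L >= b], the second when [L < b]. It bounds weight at [th] by
    reference mass plus a lower tail. *)
Lemma tilt_lower_tail (th s b L : R) : th <= 1 -> 0 <= s ->
  exp (- (1 - th) * L) <=
  exp (- (1 - th) * b) + exp (s * b) * exp (- (1 - (th - s)) * L).
Proof.
move=> hth hs; rewrite -exp_plus.
case: (Rle_lt_dec b L) => h.
  have : exp (- (1 - th) * L) <= exp (- (1 - th) * b) by apply: exp_le_compat; nra.
  by have := exp_pos (s * b + - (1 - (th - s)) * L); lra.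
have : exp (- (1 - th) * L) <= exp (s * b + - (1 - (th - s)) * L).
  by apply: exp_le_compat; nra.
by have := exp_pos (- (1 - th) * b); lra.
Qed.

(** With the first letter pinned, the initial law enters a lower bound only through the constant
    [PM1 m0] or [PXZ1 y0]. *)
Definition from {T : eqType} (x0 : T) (f : seq T -> R) (s : seq T) : R :=
  match s with
  | [::] => 0
  | x :: s' => if x == x0 then f s' else 0
  end.

Lemma sumR_from {T : finType} (n : nat) (x0 : T) (f : seq T -> R) :
  sumR (fun s : n.+1.-tuple T => from x0 f s) = sumR (fun s : n.-tuple T => f s).
Proof.
rewrite sumR_tupleS /= -(sumR_delta x0 (fun=> sumR (fun s : n.-tuple T => f s))).
by apply: eq_sumR => x; case: eqP => // _; apply: sumR0.
Qed.

(** For a fixed input, passing from output to noise translates each [X]-component, which is a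
    bijection. *)
Lemma sumR_noise {X : finZmodType} {Z : finType} (n : nat) (xt : seq X)
  (F : seq (X * Z) -> R) : size xt = n ->
  sumR (fun y : n.-tuple (X * Z) => F (noise_of xt y)) = sumR (fun w : n.-tuple (X * Z) => F w).
Proof.
elim: n xt F => [|n IH] [|a xt] F //= hsz.
  by rewrite (@sumR_tuple0 _ (fun s => F (noise_of [::] s))) (@sumR_tuple0 _ F).
case: hsz => /IH {}IH.
rewrite (@sumR_tupleS _ n (fun s => F (noise_of (a :: xt) s))) (@sumR_tupleS _ n F).
rewrite (@eq_sumR _ _ (fun y0 => sumR (fun w : n.-tuple (X * Z) =>
   F ((GRing.add y0.1 (GRing.opp a), y0.2) :: w)))); last first.
  by move=> y0; rewrite -(IH (fun w => F (_ :: w))).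
pose sh (c : X) (p : X * Z) := (GRing.add p.1 c, p.2).
rewrite /sumR [RHS](reindex (sh (GRing.opp a))) //=.
exists (sh a) => -[p1 p2] _; rewrite /sh /=.
  by rewrite GRing.subrK.
by rewrite GRing.addrK.
Qed.

Definition lift_snd {X Z : Type} (V : Z -> Z -> R) (y y' : X * Z) : R := V y.2 y'.2.

Lemma pchain_lift_noise {X : finZmodType} {Z : finType} (V1 V2 : Z -> Z -> R) (n1 : nat)
  (a a' : X) (z : Z) (xt : seq X) (y : seq (X * Z)) : size xt = size y ->
  pchain (lift_snd V1) (lift_snd V2) n1 (a, z) (noise_of xt y) =
  pchain (lift_snd V1) (lift_snd V2) n1 (a', z) y.
Proof.
elim: y xt n1 a a' z => [|[b z'] y IH] [|x xt] n1 a a' z //= [] hsz.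
by case: n1 => [|n1] /=; congr Rmult; apply: IH.
Qed.

Lemma pchain1 {T : Type} (n1 : nat) (x : T) (s : seq T) :
  pchain (fun _ _ => 1) (fun _ _ => 1) n1 x s = 1.
Proof.
by elim: s n1 x => [|y s IH] [|n1] x //=; rewrite IH Rmult_1_l.
Qed.

(** * Change of measure and counting for a code *)

Section CodeBound.
Context (M : finType) (PM1 : M -> R) (Ws : M -> M -> R).
Context (X : finZmodType) (Z : finType) (PXZ1 : X * Z -> R) (Wc : X * Z -> X * Z -> R).
Hypothesis PM1_ge0 : forall m, 0 <= PM1 m.
Hypothesis Ws_ge0 : forall m m', 0 <= Ws m m'.
Hypothesis PXZ1_ge0 : forall y, 0 <= PXZ1 y.
Hypothesis Wc_ge0 : forall y y', 0 <= Wc y y'.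
Context (m0 : M) (y0 : X * Z) (V1 V2 : Z -> Z -> R) (c : R).
Hypothesis stV1 : stochastic V1.
Hypothesis stV2 : stochastic V2.
Hypothesis c_gt0 : 0 < c.
Hypothesis Ws_c : forall m m', 0 < Ws m m' -> c <= Ws m m'.
Hypothesis Wc_c : forall y y', 0 < Wc y y' -> c <= Wc y y'.
Hypothesis Wc_V1 : forall y y', 0 < Wc y y' -> 0 < V1 y.2 y'.2.
Hypothesis Wc_V2 : forall y y', 0 < Wc y y' -> 0 < V2 y.2 y'.2.

Definition source_weight (t : R) (k1 : nat) (m : seq M) : R :=
  pchain (tilt Ws (fun _ _ => 1) t) (tilt Ws (fun _ _ => 1) 1) k1 m0 m.
Definition noise_weight (t : R) (n1 : nat) (w : seq (X * Z)) : R :=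
  pchain (tilt Wc (lift_snd V1) t) (tilt Wc (lift_snd V2) 1) n1 y0 w.
(** The first letter is free here, so the weight of the noise seen from a codeword depends on the
    output alone. *)
Definition reference_weight (n1 : nat) (w : seq (X * Z)) : R :=
  match w with
  | [::] => 0
  | y :: w' => pchain (lift_snd V1) (lift_snd V2) n1 y w'
  end.
Definition total_weight (t : R) (k1 k2 n1 n2 : nat) : R :=
  sumR (fun m : (addn k1 k2).-tuple M => source_weight t k1 m) *
  sumR (fun w : (addn n1 n2).-tuple (X * Z) => noise_weight t n1 w).

Lemma reference_weight_ge0 (n1 : nat) (w : seq (X * Z)) : 0 <= reference_weight n1 w.
Proof.
case: w => [|y w] /=; first lra.
by case: stV1 stV2 => h1 _ [h2 _]; apply: pchain_ge0 => i j; [apply: h1|apply: h2].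
Qed.

(** Each step contributes [#|X|], since [V] is stochastic in [z] and constant in [x]; the free first
    letter contributes [#|X| * #|Z|]. *)
Lemma sumR_reference_weight (n n1 : nat) :
  sumR (fun w : n.+1.-tuple (X * Z) => reference_weight n1 w) = INR #|Z| * INR #|X| ^ n.+1.
Proof.
have h V : stochastic V -> forall y : X * Z, sumR (fun y' => lift_snd V y' y) = INR #|X|.
  move=> [_ h1] y; rewrite sumR_pair (@eq_sumR _ _ (fun=> 1)) => [|x]; last exact: h1.
  by rewrite sumR_const Rmult_1_r.
rewrite sumR_tupleS /= (@eq_sumR _ _ (fun=> INR #|X| ^ n)); last first.
  by move=> y; apply: sumR_pchain_const => j; apply: h.
by rewrite sumR_const card_prod mult_INR -Rmult_assoc; congr Rmult; apply: Rmult_comm.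
Qed.

(** [L] adds the log-likelihood ratios of source and noise. The source reference is constantly 1, so
    only the noise reference remains; the second phases cost one factor [c] per step. *)
Lemma likelihood_ratio (k1 k2 n1 n2 : nat) (m : (addn k1 k2).+1.-tuple M) (w : seq (X * Z)) :
  size w = (addn n1 n2).+1 ->
  let q t := from m0 (source_weight t k1) m * from y0 (noise_weight t n1) w in
  let p := markov PM1 Ws m * markov PXZ1 Wc w in
  0 <= p /\
  ((forall t, q t = 0) \/
   exists L, (forall t, q t = exp (- (1 - t) * L) * reference_weight n1 w) /\
     PM1 m0 * PXZ1 y0 * c ^ (addn k2 n2) * (exp (- L) * reference_weight n1 w) <= p).
Proof.
have chain_ge0 (T : Type) (W : T -> T -> R) x s : (forall i j, 0 <= W i j) -> 0 <= chain W x s.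
  by move=> h; elim: s x => [|y s IH] x /=; [lra|apply: Rmult_le_pos].
case: m => -[|m1 m] //= hm; case: w => [|w1 w] //= [hw].
have sm : size m = addn k1 k2 by move/eqP: hm => [].
split; first by apply: Rmult_le_pos; apply: Rmult_le_pos => //; apply: chain_ge0.
case: eqP => [->|_]; last by left=> t; rewrite Rmult_0_l.
case: eqP => [->|_]; last by left=> t; rewrite Rmult_0_r.
have c_ge0 := Rlt_le _ _ c_gt0.
case: (pchain_tilt Ws (fun _ _ => 1) (fun _ _ => 1) c k1 m0 m) => //; try by move=> *; lra.
  by move=> [_ h]; left=> t; rewrite /source_weight h Rmult_0_l.
move=> [Ls [hs1 _ hs3 hs4]].
case: (pchain_tilt Wc (lift_snd V1) (lift_snd V2) c n1 y0 w) => //.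
    by move=> i j h; split; [apply: Wc_V2|apply: (stochastic_le1 V2 stV2 i.2 j.2)].
  by move=> [_ h]; left=> t; rewrite /noise_weight h Rmult_0_r.
move=> [Lc [hc1 hc2 hc3 hc4]].
right; exists (Ls + Lc); split.
  move=> t; rewrite /source_weight /noise_weight hs4 hc4 pchain1 Rmult_plus_distr_l exp_plus.
  by rewrite Rmult_1_r Rmult_assoc.
move: hs3 hc3; rewrite sm hw !addKn pchain1 Rmult_1_r => hs3 hc3.
rewrite Ropp_plus_distr exp_plus pow_add.
have -> : PM1 m0 * chain Ws m0 m * (PXZ1 y0 * chain Wc y0 w) =
  PM1 m0 * PXZ1 y0 * (chain Ws m0 m * chain Wc y0 w) by ring.
rewrite Rmult_assoc; apply: Rmult_le_compat_l; first exact: Rmult_le_pos.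
apply: Rle_trans (Rmult_le_compat _ _ _ _ _ _ hs3 hc3).
- by rewrite -!Rmult_assoc; apply: Rmult_le_compat_r; [apply: Rlt_le|apply: Req_le; ring].
- by apply: Rmult_le_pos; [apply: pow_le|apply/Rlt_le/exp_pos].
- apply: Rmult_le_pos; last exact: Rlt_le.
  by apply: Rmult_le_pos; [apply: pow_le|apply/Rlt_le/exp_pos].
Qed.

(** For a correctly decoded pair the right side is 0 and [tilt_lower_tail] makes the bracket
    nonpositive; for an error [tilt_upper_tail] applies. *)
Lemma pointwise_bound (k1 k2 n1 n2 : nat) (m : (addn k1 k2).+1.-tuple M) (w : seq (X * Z))
  (th s b b' : R) (ok : bool) :
  size w = (addn n1 n2).+1 -> 0 <= th <= 1 -> 0 <= s ->
  let q t := from m0 (source_weight t k1) m * from y0 (noise_weight t n1) w in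
  PM1 m0 * PXZ1 y0 * c ^ (addn k2 n2) * exp (- th * b) *
  (q th - exp (- s * b) * q (th + s) - exp (s * b') * q (th - s)
   - exp (- (1 - th) * b') * (if ok then reference_weight n1 w else 0))
  <= markov PM1 Ws m * markov PXZ1 Wc w * (if ok then 0 else 1).
Proof.
move=> hw hth hs q.
have [] := likelihood_ratio k1 k2 n1 n2 m w hw.
set p := markov PM1 Ws m * _; rewrite -/q => hp.
have := reference_weight_ge0 n1 w; set v := reference_weight n1 w => hv.
have hK : 0 <= PM1 m0 * PXZ1 y0 * c ^ (addn k2 n2).
  by apply: Rmult_le_pos; [apply: Rmult_le_pos|apply/pow_le/Rlt_le].
set K := PM1 m0 * PXZ1 y0 * c ^ (addn k2 n2) in hK *.
have hE := exp_pos (- th * b).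
case=> [q0|[L [qE hL]]].
  rewrite /q !q0 !Rmult_0_r !Rminus_0_r Rminus_0_l.
  have h1 : 0 <= exp (- (1 - th) * b') * (if ok then v else 0).
    by apply: Rmult_le_pos; [apply/Rlt_le/exp_pos|case: ok; lra].
  have h2 : 0 <= K * exp (- th * b) by apply: Rmult_le_pos; lra.
  by apply: Rle_trans (_ : 0 <= _); [nra|case: (ok); lra].
rewrite /q !qE; case: ok.
  have h := tilt_lower_tail th s b' L (proj2 hth) hs.
  rewrite Rmult_0_r; apply: Rle_trans (_ : K * exp (- th * b) * 0 <= 0); last lra.
  apply: Rmult_le_compat_l; first by apply: Rmult_le_pos; lra.
  have h2 : 0 <= exp (- s * b) * (exp (- (1 - (th + s)) * L) * v).
    by apply: Rmult_le_pos; [apply/Rlt_le/exp_pos|apply: Rmult_le_pos => //; apply/Rlt_le/exp_pos].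
  have := Rmult_le_compat_r v _ _ hv h; rewrite Rmult_plus_distr_r Rmult_assoc; lra.
rewrite Rmult_1_r Rmult_0_r Rminus_0_r.
apply: Rle_trans hL; rewrite Rmult_assoc; apply: Rmult_le_compat_l => //.
have h := tilt_upper_tail th s b L (proj1 hth) hs.
have h2 : 0 <= exp (s * b') * (exp (- (1 - (th - s)) * L) * v).
  by apply: Rmult_le_pos; [apply/Rlt_le/exp_pos|apply: Rmult_le_pos => //; apply/Rlt_le/exp_pos].
apply: Rle_trans (Rmult_le_compat_r v _ _ hv h).
rewrite Rmult_assoc; apply: Rmult_le_compat_l; lra.
Qed.

Lemma err_prob_lower_bound (k1 k2 n1 n2 : nat) (th s b b' : R)
  (e : {ffun (addn k1 k2).+1.-tuple M -> (addn n1 n2).+1.-tuple X})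
  (d : {ffun (addn n1 n2).+1.-tuple (X * Z) -> (addn k1 k2).+1.-tuple M}) :
  0 <= th <= 1 -> 0 <= s ->
  PM1 m0 * PXZ1 y0 * c ^ (addn k2 n2) * exp (- th * b) *
  (total_weight th k1 k2 n1 n2 - exp (- s * b) * total_weight (th + s) k1 k2 n1 n2
   - exp (s * b') * total_weight (th - s) k1 k2 n1 n2
   - exp (- (1 - th) * b') * (INR #|Z| * INR #|X| ^ (addn n1 n2).+1))
  <= err_prob PM1 Ws PXZ1 Wc e d.
Proof.
move=> hth hs.
have sz (y : (addn n1 n2).+1.-tuple (X * Z)) xt : size xt = (addn n1 n2).+1 ->
    size (noise_of xt y) = (addn n1 n2).+1.
  by move=> h; rewrite /noise_of size_map size_zip size_tuple h minnn.
pose q t (m : (addn k1 k2).+1.-tuple M) (y : (addn n1 n2).+1.-tuple (X * Z)) :=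
  from m0 (source_weight t k1) m * from y0 (noise_weight t n1) (noise_of (e m) y).
pose g m (y : (addn n1 n2).+1.-tuple (X * Z)) :=
  if d y == m then reference_weight n1 (noise_of (e m) y) else 0.
have total t : total_weight t k1 k2 n1 n2 = sumR (fun m => sumR (q t m)).
  rewrite /total_weight -(sumR_from _ m0 (source_weight t k1)).
  rewrite -(sumR_from _ y0 (noise_weight t n1)) -sumR_mulr; apply: eq_sumR => m.
  by rewrite /q sumR_mull (sumR_noise _ _ (from y0 (noise_weight t n1))) ?size_tuple.
(* Each output is decoded to one message, so after exchanging the sums one term per output is left,
   and its weight is independent of the codeword. *)
have count : sumR (fun m => sumR (g m)) = INR #|Z| * INR #|X| ^ (addn n1 n2).+1.
  rewrite -(sumR_reference_weight _ n1) sumR_exchange; apply: eq_sumR => y.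
  rewrite -(sumR_delta (d y) (fun=> reference_weight n1 y)); apply: eq_sumR => m.
  rewrite /g eq_sym; case: eqP => // _.
  have := size_tuple (e m); case: (tval (e m)) => // x xt.
  case: y => -[|[a z] y] //= hy [hx]; apply: pchain_lift_noise.
  by move/eqP: hy => [->].
have -> : err_prob PM1 Ws PXZ1 Wc e d =
  sumR (fun m : (addn k1 k2).+1.-tuple M => sumR (fun y : (addn n1 n2).+1.-tuple (X * Z) =>
    markov PM1 Ws m * markov PXZ1 Wc (noise_of (e m) y) * (if d y == m then 0 else 1))).
  by apply: eq_sumR => m; rewrite -sumR_mull; apply: eq_sumR => y; ring.
set K := PM1 m0 * _ * _ * _.
have -> : K * (total_weight th k1 k2 n1 n2 - exp (- s * b) * total_weight (th + s) k1 k2 n1 n2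
   - exp (s * b') * total_weight (th - s) k1 k2 n1 n2
   - exp (- (1 - th) * b') * (INR #|Z| * INR #|X| ^ (addn n1 n2).+1)) =
  sumR (fun m : (addn k1 k2).+1.-tuple M => sumR (fun y : (addn n1 n2).+1.-tuple (X * Z) => K * (q th m y - exp (- s * b) * q (th + s) m y
   - exp (s * b') * q (th - s) m y - exp (- (1 - th) * b') * g m y))).
  rewrite -count !total -!sumR_mull -!sumRB -sumR_mull; apply: eq_sumR => m.
  by rewrite -!sumR_mull -!sumRB -sumR_mull; apply: eq_sumR.
apply: sumR_le => m; apply: sumR_le => y.
by apply: pointwise_bound => //; apply: sz; rewrite size_tuple.
Qed.

End CodeBound.

(** * The exponent *)

Lemma Rsup_is_lub (P : R -> Prop) (B : R) :
  (forall x, P x -> x <= B) -> (exists x, P x) -> is_lub P (Rsup P).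
Proof.
move=> hB hP; apply: epsilon_spec.
by have [l hl] := completeness P (ex_intro _ B hB) hP; exists l.
Qed.

Lemma Rsup_approx (P : R -> Prop) (e : R) :
  is_lub P (Rsup P) -> 0 < e -> exists2 x, P x & Rsup P - e < x.
Proof.
move=> [_ h] he; case: (classic (exists2 x, P x & Rsup P - e < x)) => // hn.
have : Rsup P <= Rsup P - e; last lra.
by apply: h => x hx; apply: Rnot_lt_le => hlt; apply: hn; exists x.
Qed.

Lemma derivable_pt_lim_linear (f : R -> R) (x l e : R) :
  derivable_pt_lim f x l -> 0 < e ->
  exists2 d, 0 < d & forall h, Rabs h < d -> Rabs (f (x + h) - f x - l * h) <= e * Rabs h.
Proof.
move=> hf he; have [d hd] := hf e he; exists d => [|h hh]; first exact: cond_pos.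
case: (Req_dec h 0) => [->|h0].
  rewrite Rplus_0_r Rmult_0_r Rminus_diag Rminus_diag Rabs_R0; lra.
have -> : f (x + h) - f x - l * h = ((f (x + h) - f x) / h - l) * h by field.
rewrite Rabs_mult; apply: Rmult_le_compat_r; first exact: Rabs_pos.
exact/Rlt_le/hd.
Qed.

Lemma eventually_linear (A B : R) : 0 < B ->
  exists N : nat, forall n : nat, leq N n -> A <= B * INR n.
Proof.
move=> hB; have [N hN] := INR_unbounded (A / B); exists N => n /leP /le_INR hn.
have -> : A = B * (A / B) by field; lra.
by apply: Rmult_le_compat_l; lra.
Qed.

Lemma floorR_bounds (x : R) : 0 <= x -> INR (floorR x) <= x < INR (floorR x) + 1.
Proof.
move=> hx; have [h1 h2] := base_Int_part x.
have h0 : (0 <= Int_part x)%Z.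
  have : IZR (-1) < IZR (Int_part x) by rewrite /=; lra.
  by move/lt_IZR; lia.
by rewrite /floorR INR_IZR_INZ Znat.Z2Nat.id //; lra.
Qed.

(** [n2] and [k2] are the floors of [beta * n] and [r * n2]. The first letter of each sequence
    belongs to neither phase, whence the successors and the strict inequalities [n2 < n] and
    [k2 < k]. *)
Lemma split_lengths (r beta : R) : 0 < r -> 0 < beta <= 1 / 2 ->
  exists N : nat, forall n : nat, leq N n -> exists k1 k2 n1 n2 : nat,
    [/\ n = (addn n1 n2).+1, floorR (r * INR n) = (addn k1 k2).+1,
        Rabs (INR k1 - r * INR n1) <= r + 2, r * INR n2 - 1 <= INR k2 <= r * INR n2 &
        beta * INR n - 1 <= INR n2 <= beta * INR n].
Proof.
move=> hr hb; have [N hN] := eventually_linear 4 (Rmin 1 r) (Rmin_glb_lt _ _ _ Rlt_0_1 hr).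
exists N => n /hN hn; have n0 := pos_INR n.
have h1 : 4 <= INR n by have := Rmin_l 1 r; nra.
have h2 : 4 <= r * INR n by have := Rmin_r 1 r; nra.
have b0 : 0 <= beta * INR n by nra.
have [l1 l2] := floorR_bounds (beta * INR n) b0.
set n2 := floorR (beta * INR n) in l1 l2.
have r2 : 0 <= r * INR n2 by have := pos_INR n2; nra.
have [l3 l4] := floorR_bounds (r * INR n2) r2.
set k2 := floorR (r * INR n2) in l3 l4.
have rn : 0 <= r * INR n by lra.
have [l5 l6] := floorR_bounds (r * INR n) rn.
set k := floorR (r * INR n) in l5 l6 *.
have ln2 : (n2 < n)%coq_nat by apply: INR_lt; nra.
have lk2 : (k2 < k)%coq_nat by apply: INR_lt; nra.
have En : n = S (Nat.add (n - S n2)%coq_nat n2) by lia.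
have Ek : k = S (Nat.add (k - S k2)%coq_nat k2) by lia.
exists (k - S k2)%coq_nat, k2, (n - S n2)%coq_nat, n2; split=> //; last lra; last lra.
have := f_equal INR En; have := f_equal INR Ek; rewrite !S_INR !plus_INR => e1 e2.
by apply: Rabs_le; nra.
Qed.

(** [Rsup] satisfies its specification on a nonempty bounded set: [B] supplies the bound and a
    constant code an element. *)
Lemma Pj_ge (M : finType) (X : finZmodType) (Z : finType)
  (PM1 : M -> R) (Ws : M -> M -> R) (PXZ1 : X * Z -> R) (Wc : X * Z -> X * Z -> R)
  (m0 : M) (k n : nat) (B : R) :
  (forall e d, B <= @err_prob M X Z PM1 Ws PXZ1 Wc k n e d) ->
  B <= Pj PM1 Ws PXZ1 Wc k n.
Proof.
move=> hB; rewrite /Pj /Rinf; set P := fun x : R => _.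
have [] // : is_lub P (Rsup P).
  apply: (Rsup_is_lub _ (- B)) => [x [e [d he]]|]; first by have := hB e d; lra.
  pose e : {ffun k.-tuple M -> n.-tuple X} := [ffun=> [tuple of nseq n (GRing.zero : X)]].
  pose d : {ffun n.-tuple (X * Z) -> k.-tuple M} := [ffun=> [tuple of nseq k m0]].
  by exists (- err_prob PM1 Ws PXZ1 Wc e d), e, d; rewrite Ropp_involutive.
move=> _ h; have : Rsup P <= - B; last lra.
by apply: h => x [e [d he]]; have := hB e d; lra.
Qed.

Lemma positive_entries_lower_bound {T : finType} (W : T -> T -> R) :
  exists2 c, 0 < c & forall i j, 0 < W i j -> c <= W i j.
Proof.
have [|c hc h] := finite_lower_bound (fun p : T * T => if Rlt_dec 0 (W p.1 p.2) then W p.1 p.2 else 1).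
  by move=> p; case: Rlt_dec => //= _; lra.
exists c => // i j hij; have := h (i, j); rewrite /=.
by case: Rlt_dec.
Qed.

(** * The exponent as a supremum of convex functions *)

Section Exponent.
Context (M : finType) (Ws : M -> M -> R) (X : finZmodType) (Z : finType).
Context (Wc : X * Z -> X * Z -> R) (m0 : M) (y0 : X * Z) (r : R).
Hypothesis stWs : stochastic Ws.
Hypothesis irrWs : irreducible Ws.
Hypothesis stWc : stochastic Wc.
Hypothesis irrWc : irreducible Wc.
Hypothesis A2 : Assumption2 Wc.
Hypothesis r_gt0 : 0 < r.

(** [WcZ] fixes the previous group element at 0. Clause (i) at [theta = 0] carries the sum over to
    any [x']; for a singleton [Z] it is a whole column sum. *)
Lemma WcZ_gt0 (y y' : X * Z) : 0 < Wc y y' -> 0 < WcZ Wc y.2 y'.2.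
Proof.
case: y y' => [x z] [x' z'] /= h; rewrite /WcZ; case: (stWc) => h0 h1.
case: A2 => [hA|hZ].
  have E a : sumR (fun x => Wc (x, z) (a, z')) = sumR (fun x => rpow (Wc (x, z) (a, z')) (1 - 0)).
    apply: eq_sumR => x1; case: (Rlt_dec 0 (Wc (x1, z) (a, z'))) => hlt.
      by rewrite rpow_pos // Rminus_0_r Rmult_1_l exp_ln.
    by rewrite rpow_npos //; have := h0 (x1, z) (a, z'); lra.
  rewrite E (hA 0 Rlt_0_1 z z' _ x') -E.
  exact: (sumR_gt0 (fun x => Wc (x, z) (x', z')) x).
have [|[x1 z1] h2] := @sumR_gt0_ex _ (fun y => Wc y (GRing.zero, z')).
  by rewrite h1; lra.
apply: (sumR_gt0 (fun x => Wc (x, z) (GRing.zero, z')) x1) => //.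
have /fintype_le1P Z1 : leq #|Z| 1 by rewrite hZ.
by rewrite (Z1 z1 z).
Qed.

Lemma WcZ_admissible : admissibleV Wc (WcZ Wc).
Proof.
case: (stWc) => h0 h1; split=> //; split=> [z z'|z']; first exact: sumR_ge0.
by rewrite -(h1 (GRing.zero, z')) sumR_pair sumR_exchange.
Qed.

Lemma admissible_lift (V : Z -> Z -> R) : admissibleV Wc V ->
  (forall y y', 0 < Wc y y' -> 0 < lift_snd V y y') /\
  (forall y y' : X * Z, lift_snd V y y' <= 1).
Proof.
move=> [hV hVZ]; split=> [y y' /WcZ_gt0|y y']; first exact: hVZ.
exact: (stochastic_le1 V hV y.2 y'.2).
Qed.

Definition exponent (V : Z -> Z -> R) (t : R) : R :=
  r * lam Ws (fun _ _ => 1) t + lam Wc (lift_snd V) t.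

Lemma Hup_is_lub (t : R) : 0 < t <= 1 ->
  is_lub (fun h => exists V, admissibleV Wc V /\ h = HcV Wc V t) (Hup Wc t).
Proof.
move=> ht; apply: (Rsup_is_lub _ (/ t * ln (INR #|{: X * Z}|))).
  move=> _ [V [hV ->]]; have [h1 h2] := admissible_lift V hV.
  apply: Rmult_le_compat_l; first by apply/Rlt_le/Rinv_0_lt_compat; lra.
  by apply: (lam_le_card y0 Wc (lift_snd V)) => //; lra.
by exists (HcV Wc (WcZ Wc) t), (WcZ Wc); split=> //; apply: WcZ_admissible.
Qed.

Lemma exponent_le_Uup (V : Z -> Z -> R) (t : R) : admissibleV Wc V -> 0 <= t <= 1 ->
  exponent V t <= Uup Ws Wc r t.
Proof.
move=> hV ht; have [h1 h2] := admissible_lift V hV.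
rewrite /exponent /Uup thetaHs_lam; apply: Rplus_le_compat_l.
case: Req_EM_T => [E|t0] /=; first by rewrite E (lam0 y0) //; lra.
have tpos : 0 < t <= 1 by lra.
have [/(_ (HcV Wc V t)) h _] := Hup_is_lub t tpos.
have {}h := h (ex_intro _ V (conj hV erefl)).
have -> : lam Wc (lift_snd V) t = t * HcV Wc V t.
  by rewrite /HcV -Rmult_assoc Rinv_r ?Rmult_1_l.
by apply: Rmult_le_compat_l; lra.
Qed.

Lemma exponent_approx (t e : R) : 0 < t <= 1 -> 0 < e ->
  exists2 V, admissibleV Wc V & Uup Ws Wc r t - e < exponent V t.
Proof.
move=> ht he.
have [|_ [V [hV ->]] h] := Rsup_approx _ e (Hup_is_lub t ht) => //.
exists V => //; rewrite /exponent /Uup thetaHs_lam.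
case: Req_EM_T => [|_] /=; first lra.
have -> : lam Wc (lift_snd V) t = t * HcV Wc V t.
  by rewrite /HcV -Rmult_assoc Rinv_r ?Rmult_1_l //; lra.
rewrite -/(Hup Wc t) in h.
have h' : t * (Hup Wc t - e) < t * HcV Wc V t by apply: Rmult_lt_compat_l; lra.
have : t * e <= e; nra.
Qed.

(** A [V] nearly optimal at the intermediate point has a convex exponent, which lies below [Uup] at
    both ends. *)
Lemma Uup_convex (p t0 t1 : R) : 0 <= p <= 1 -> 0 <= t0 <= 1 -> 0 <= t1 <= 1 ->
  0 < (1 - p) * t0 + p * t1 ->
  Uup Ws Wc r ((1 - p) * t0 + p * t1) <= (1 - p) * Uup Ws Wc r t0 + p * Uup Ws Wc r t1.
Proof.
move=> hp h0 h1 ht; apply: le_epsilon => e he.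
have ht1 : 0 < (1 - p) * t0 + p * t1 <= 1 by nra.
have [V hV hlt] := exponent_approx _ e ht1 he.
have [hV1 hV2] := admissible_lift V hV.
have c1 := lam_convex m0 Ws (fun _ _ => 1) stWs irrWs (fun _ _ _ => Rlt_0_1) p t0 t1 hp.
have c2 := lam_convex y0 Wc (lift_snd V) stWc irrWc hV1 p t0 t1 hp.
have := exponent_le_Uup V t0 hV h0; have := exponent_le_Uup V t1 hV h1.
move: hlt; rewrite /exponent => hlt u1 u0.
have c1' := Rmult_le_compat_l r _ _ (Rlt_le _ _ r_gt0) c1.
have u0' := Rmult_le_compat_l (1 - p) _ _ ltac:(lra) u0.
have u1' := Rmult_le_compat_l p _ _ ltac:(lra) u1.
lra.
Qed.

(** If [U t] were below the tangent by [g], convexity would put [U (th + p * h)] below it by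
    [p * g], more than the error [g * p * Rabs h / 2] allowed by differentiability. *)
Lemma Uup_tangent (th dU t : R) : 0 < th < 1 -> derivable_pt_lim (Uup Ws Wc r) th dU ->
  0 <= t <= 1 -> Uup Ws Wc r th + dU * (t - th) <= Uup Ws Wc r t.
Proof.
move=> hth hd ht; set h := t - th.
apply: Rnot_lt_le => hlt; pose g := Uup Ws Wc r th + dU * h - Uup Ws Wc r t.
have g0 : 0 < g by rewrite /g; lra.
have h1 : Rabs h < 1 by apply: Rabs_def1; rewrite /h; lra.
have [d d0 hdd] := derivable_pt_lim_linear _ _ _ (g / 2) hd (ltac:(lra)).
pose p := Rmin (1 / 2) (d / 2).
have p0 : 0 < p by apply: Rmin_glb_lt; lra.
have p1 : p <= 1 / 2 by apply: Rmin_l.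
have p2 : p <= d / 2 by apply: Rmin_r.
have hp : Rabs (p * h) = p * Rabs h by rewrite Rabs_mult Rabs_pos_eq; lra.
have := Rabs_pos h => ah.
have := hdd (p * h); rewrite hp => /(_ ltac:(nra)) hh.
have := Uup_convex p th t; have -> : (1 - p) * th + p * t = th + p * h by rewrite /h; ring.
move=> /(_ ltac:(lra) ltac:(lra) ltac:(lra) ltac:(rewrite /h; nra)) hc.
have := Rle_abs (- (Uup Ws Wc r (th + p * h) - Uup Ws Wc r th - dU * (p * h))).
rewrite Rabs_Ropp => hab.
have E : p * g = p * Uup Ws Wc r th + p * (dU * h) - p * Uup Ws Wc r t by rewrite /g; ring.
have h2 : g * p <= g * p * (Rabs h / 2) by lra.
have := Rmult_lt_0_compat _ _ g0 p0; nra.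
Qed.

(** [K] absorbs the eigenvector constants and the bounded deviations of [k1], [k2] from [r * n1],
    [r * n2]. *)
Lemma total_weight_bounds (V1 V2 : Z -> Z -> R) (t : R) :
  admissibleV Wc V1 -> admissibleV Wc V2 ->
  exists K, forall k1 k2 n1 n2,
    Rabs (INR k1 - r * INR n1) <= r + 2 -> r * INR n2 - 1 <= INR k2 <= r * INR n2 ->
    exp (INR n1 * exponent V1 t + INR n2 * exponent V2 1 - K) <=
    total_weight M Ws X Z Wc m0 y0 V1 V2 t k1 k2 n1 n2
    <= exp (INR n1 * exponent V1 t + INR n2 * exponent V2 1 + K).
Proof.
move=> hV1 hV2; have [p1 q1] := admissible_lift V1 hV1; have [p2 q2] := admissible_lift V2 hV2.
pose one (_ _ : M) := 1.
have pone i j : 0 < Ws i j -> 0 < one i j by move=> _; apply: Rlt_0_1.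
have [u1 [_ [hu1 E1 _ _]]] := tilt_eigenvectors m0 Ws one stWs irrWs pone t.
have [u2 [_ [hu2 E2 _ _]]] := tilt_eigenvectors m0 Ws one stWs irrWs pone 1.
have [u3 [_ [hu3 E3 _ _]]] := tilt_eigenvectors y0 Wc _ stWc irrWc p1 t.
have [u4 [_ [hu4 E4 _ _]]] := tilt_eigenvectors y0 Wc _ stWc irrWc p2 1.
have [K1 h1] := sumR_pchain_bounds _ _ _ _ u1 u2 (tilt_ge0 _ _ t) hu1 E1 (tilt_ge0 _ _ 1) hu2 E2.
have [K2 h2] := sumR_pchain_bounds _ _ _ _ u3 u4 (tilt_ge0 _ _ t) hu3 E3 (tilt_ge0 _ _ 1) hu4 E4.
set l1 := lam Ws one t in h1; set l2 := lam Ws one 1 in h1.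
exists (K1 + K2 + (r + 2) * Rabs l1 + Rabs l2) => k1 k2 n1 n2 hk1 hk2.
have {h1} [a1 b1] := h1 k1 k2 m0; have {h2} [a2 b2] := h2 n1 n2 y0.
rewrite /total_weight /source_weight /noise_weight /exponent -/one -/l1 -/l2.
set l3 := lam Wc (lift_snd V1) t in a2 b2 *; set l4 := lam Wc (lift_snd V2) 1 in a2 b2 *.
have d1 : Rabs ((INR k1 - r * INR n1) * l1) <= (r + 2) * Rabs l1.
  by rewrite Rabs_mult; apply: Rmult_le_compat_r; first exact: Rabs_pos.
have d2 : Rabs ((INR k2 - r * INR n2) * l2) <= Rabs l2.
  rewrite Rabs_mult -{2}(Rmult_1_l (Rabs l2)); apply: Rmult_le_compat_r; first exact: Rabs_pos.
  by apply: Rabs_le; lra.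
have e1 := Rle_abs ((INR k1 - r * INR n1) * l1); have e2 := Rle_abs ((INR k2 - r * INR n2) * l2).
have f1 := Rle_abs (- ((INR k1 - r * INR n1) * l1)); have f2 := Rle_abs (- ((INR k2 - r * INR n2) * l2)).
rewrite !Rabs_Ropp in f1 f2.
split.
  apply: Rle_trans (Rmult_le_compat _ _ _ _ _ _ a1 a2); try exact/Rlt_le/exp_pos.
  by rewrite -exp_plus; apply: exp_le_compat; lra.
apply: Rle_trans (Rmult_le_compat _ _ _ _ _ _ b1 b2) _.
- exact: Rle_trans (Rlt_le _ _ (exp_pos _)) a1.
- exact: Rle_trans (Rlt_le _ _ (exp_pos _)) a2.
- by rewrite -exp_plus; apply: exp_le_compat; lra.
Qed.

End Exponent.

(** * Assembling the bound *)

Lemma four_exp_le (x : R) : 4 * exp (x - 2) <= exp x.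
Proof.
have E : exp x = exp (x - 2) * (exp 1 * exp 1) by rewrite -!exp_plus; congr exp; ring.
have := exp_ineq1_le 1; have := exp_pos (x - 2); rewrite E => h1 h2.
have : 4 <= exp 1 * exp 1 by nra.
nra.
Qed.

Lemma exp_pow (x : R) (n : nat) : exp x ^ n = exp (INR n * x).
Proof.
elim: n => [|n IH]; first by rewrite Rmult_0_l exp_0.
by rewrite S_INR /= IH -exp_plus; congr exp; ring.
Qed.

(** The three conditions make the upper tail, the lower tail and the correctly decoded mass each at
    most a quarter of the total weight. The price [lc] of a second-phase step is fixed before all
    parameters, as [beta] is later chosen from it. *)
Lemma Pj_lower_bound
  (M : finType) (PM1 : M -> R) (Ws : M -> M -> R)
  (X : finZmodType) (Z : finType) (PXZ1 : X * Z -> R) (Wc : X * Z -> X * Z -> R)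
  (hPM1 : distr PM1) (hWs : stochastic Ws) (hWsi : irreducible Ws)
  (hPXZ1 : distr PXZ1) (hWc : stochastic Wc) (hWci : irreducible Wc)
  (hA2 : Assumption2 Wc) (r : R)
  : exists2 lc, 0 <= lc & forall (V1 V2 : Z -> Z -> R) (th s a dl : R),
    admissibleV Wc V1 -> admissibleV Wc V2 -> 0 <= th <= 1 -> 0 <= s ->
  exists K, forall k1 k2 n1 n2,
    Rabs (INR k1 - r * INR n1) <= r + 2 -> r * INR n2 - 1 <= INR k2 <= r * INR n2 ->
    let A := INR n1 * exponent M Ws X Z Wc r V1 th
             + INR n2 * exponent M Ws X Z Wc r V2 1 in
    INR n1 * (exponent M Ws X Z Wc r V1 (th + s) - exponent M Ws X Z Wc r V1 th
              - s * (a + dl)) <= - K ->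
    INR n1 * (exponent M Ws X Z Wc r V1 (th - s) - exponent M Ws X Z Wc r V1 th
              + s * (a - dl)) <= - K ->
    (INR n1 + INR n2) * ln (INR #|X|) - (1 - th) * (INR n1 * (a - dl)) - A <= - K ->
    exp (A - (INR k2 + INR n2) * lc - th * (INR n1 * (a + dl)) - K)
    <= Pj PM1 Ws PXZ1 Wc (addn k1 k2).+1 (addn n1 n2).+1.
Proof.
have [m0 hm0] : exists m, 0 < PM1 m by apply: sumR_gt0_ex; case: hPM1 => _ ->; lra.
have [y0 hy0] : exists y, 0 < PXZ1 y by apply: sumR_gt0_ex; case: hPXZ1 => _ ->; lra.
have [c1 hc1 hc1W] := positive_entries_lower_bound Ws.
have [c2 hc2 hc2W] := positive_entries_lower_bound Wc.
(* Capped at 1 so that [lc = - ln c] is nonnegative. *)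
pose c := Rmin 1 (Rmin c1 c2).
have c0 : 0 < c by apply: Rmin_glb_lt; [lra|apply: Rmin_glb_lt].
have cle1 : c <= 1 by apply: Rmin_l.
have cc1 : c <= c1 by apply: Rle_trans (Rmin_r _ _) (Rmin_l _ _).
have cc2 : c <= c2 by apply: Rle_trans (Rmin_r _ _) (Rmin_r _ _).
exists (- ln c).
  by have := ln_le_compat c 1 c0 cle1; rewrite ln_1; lra.
move=> V1 V2 th s a dl hV1 hV2 hth hs.
have [K0 h0] := total_weight_bounds M Ws X Z Wc m0 y0 r hWs hWsi hWc hWci hA2 V1 V2 th hV1 hV2.
have [Kp hp] := total_weight_bounds M Ws X Z Wc m0 y0 r hWs hWsi hWc hWci hA2 V1 V2 (th + s) hV1 hV2.
have [Km hm] := total_weight_bounds M Ws X Z Wc m0 y0 r hWs hWsi hWc hWci hA2 V1 V2 (th - s) hV1 hV2.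
have hX : 0 < INR #|X| by apply: lt_0_INR; apply/ltP/card_gt0P; exists (GRing.zero : X).
have hZ : 0 < INR #|Z| by apply: lt_0_INR; apply/ltP/card_gt0P; exists y0.2.
(* Collects the constants of the three total weights, the factors [#|Z|] and [#|X|] due to the first
   letter, the initial probabilities, and the 2 of [four_exp_le]. *)
pose K := Rabs K0 + Rabs Kp + Rabs Km + Rabs (ln (INR #|X|)) + Rabs (ln (INR #|Z|))
          + Rabs (ln (PM1 m0 * PXZ1 y0)) + 2.
have pos := Rabs_pos.
have hle := Rle_abs.
set lX := ln (INR #|X|) in K *.
have hle' x : - x <= Rabs x by rewrite -Rabs_Ropp; apply: Rle_abs.
exists K => k1 k2 n1 n2 hk1 hk2 A e1 e2 e3.
apply: (Pj_ge _ _ _ _ _ _ _ m0) => e d.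
pose b := INR n1 * (a + dl); pose b' := INR n1 * (a - dl).
apply: Rle_trans (err_prob_lower_bound M PM1 Ws X Z PXZ1 Wc _ _ _ _ m0 y0 V1 V2 c _ _ c0 _ _ _ _
  k1 k2 n1 n2 th s b b' e d hth hs); first last.
- by move=> y y' /(WcZ_gt0 X Z Wc hWc hA2); case: hV2 => _; apply.
- by move=> y y' /(WcZ_gt0 X Z Wc hWc hA2); case: hV1 => _; apply.
- by move=> y y' /hc2W; lra.
- by move=> y y' /hc1W; lra.
- by case: hV2.
- by case: hV1.
- by case: hWc.
- by case: hPXZ1.
- by case: hWs.
- by case: hPM1.
have [S0 _] := h0 k1 k2 n1 n2 hk1 hk2.
have [_ Sp] := hp k1 k2 n1 n2 hk1 hk2.
have [_ Sm] := hm k1 k2 n1 n2 hk1 hk2.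
set W0 := total_weight _ _ _ _ _ _ _ _ _ th _ _ _ _ in S0 *.
set Wp := total_weight _ _ _ _ _ _ _ _ _ (th + s) _ _ _ _ in Sp *.
set Wm := total_weight _ _ _ _ _ _ _ _ _ (th - s) _ _ _ _ in Sm *.
have HK0 := hle K0. have HKp := hle Kp. have HKm := hle Km.
have HX := hle lX. have HZ := hle (ln (INR #|Z|)).
have HP := hle' (ln (PM1 m0 * PXZ1 y0)).
have P0 := pos K0. have Pp := pos Kp. have Pm := pos Km.
have PX := pos lX. have PZ := pos (ln (INR #|Z|)).
have PP := pos (ln (PM1 m0 * PXZ1 y0)).
rewrite -/A in S0.
have t1 : exp (- s * b) * Wp <= exp (A - K0 - 2).
  apply: Rle_trans (Rmult_le_compat_l _ _ _ (Rlt_le _ _ (exp_pos _)) Sp) _.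
  rewrite -exp_plus; apply: exp_le_compat; move: e1; rewrite /A /b /K.
  lra.
have t2 : exp (s * b') * Wm <= exp (A - K0 - 2).
  apply: Rle_trans (Rmult_le_compat_l _ _ _ (Rlt_le _ _ (exp_pos _)) Sm) _.
  rewrite -exp_plus; apply: exp_le_compat; move: e2; rewrite /A /b' /K.
  lra.
have t3 : exp (- (1 - th) * b') * (INR #|Z| * INR #|X| ^ (addn n1 n2).+1) <= exp (A - K0 - 2).
  rewrite -{1}(exp_ln _ hZ) -{1}(exp_ln _ hX) -/lX.
  rewrite exp_pow S_INR plus_INR.
  rewrite -!exp_plus; apply: exp_le_compat; move: e3; rewrite /b' /K.
  lra.
have t4 := four_exp_le (A - K0).
have -> : PM1 m0 * PXZ1 y0 * c ^ addn k2 n2 * exp (- th * b) =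
  exp (ln (PM1 m0 * PXZ1 y0) + - (INR k2 + INR n2) * - ln c - th * b).
  rewrite /Rminus !exp_plus exp_ln; last exact: Rmult_lt_0_compat.
  congr (_ * _ * exp _); last ring.
  have -> : - (INR k2 + INR n2) * - ln c = (INR k2 + INR n2) * ln c by ring.
  by rewrite -{1}(exp_ln _ c0) exp_pow plus_INR.
apply: Rle_trans (Rmult_le_compat_l _ (exp (A - K0 - 2)) _ (Rlt_le _ _ (exp_pos _)) _); last lra.
rewrite -exp_plus; apply: exp_le_compat; rewrite /b /K.
lra.
Qed.

Theorem mainTheorem15
  (M : finType) (PM1 : M -> R) (Ws : M -> M -> R)
  (X : finZmodType) (Z : finType) (PXZ1 : X * Z -> R) (Wc : X * Z -> X * Z -> R)
  (hPM1 : distr PM1) (hWs : stochastic Ws) (hWsi : irreducible Ws) (hWsa : aperiodic Ws)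
  (hPXZ1 : distr PXZ1) (hWc : stochastic Wc) (hWci : irreducible Wc) (hWca : aperiodic Wc)
  (hA2 : Assumption2 Wc)
  (r : R) (hr : 0 < r)
  (hlow : r * H_s Ws + H_c Wc < ln (INR #|X|))
  (hup : ln (INR #|X|) < r * H0_s Ws + H0_up Wc)
  (theta0 dU : R) (htheta0 : 0 < theta0 < 1)
  (hdU : derivable_pt_lim (Uup Ws Wc r) theta0 dU)
  (hroot : (1 - theta0) * dU + Uup Ws Wc r theta0 = ln (INR #|X|)) :
  (forall eps : R, 0 < eps -> exists N : nat, forall n : nat, leq N n ->
      0 < Pj PM1 Ws PXZ1 Wc (floorR (r * INR n)) n /\
      - (/ INR n) * ln (Pj PM1 Ws PXZ1 Wc (floorR (r * INR n)) n)
        <= theta0 * dU - Uup Ws Wc r theta0 + eps)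
  /\ is_lub (fun v => exists theta : R, 0 <= theta < 1 /\
                 v = (theta * ln (INR #|X|) - Uup Ws Wc r theta) / (1 - theta))
            (theta0 * dU - Uup Ws Wc r theta0).
Proof.
have [m0 _] : exists m, 0 < PM1 m by apply: sumR_gt0_ex; case: hPM1 => _ ->; lra.
have [y0 _] : exists y, 0 < PXZ1 y by apply: sumR_gt0_ex; case: hPXZ1 => _ ->; lra.
set U := Uup Ws Wc r in hdU hroot *; set U0 := U theta0 in hroot *.
set lX := ln (INR #|X|) in hup hroot *; set E := theta0 * dU - U0.
split; last first.
  split=> [_ [t [ht ->]]|b hb]; last first.
    apply: hb; exists theta0; split; first lra.
    by rewrite -hroot -/U0 /E; field; lra.
  (* With [hroot] substituted for [lX], the tangent bound on the numerator is exactly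
     [(1 - t) * E]. *)
  have ht' : 0 <= t <= 1 by lra.
  have := Uup_tangent M Ws X Z Wc m0 y0 r hWs hWsi hWc hWci hA2 hr theta0 dU t htheta0 hdU ht'.
  rewrite -/U -/U0 => tan.
  apply: (Rmult_le_reg_r (1 - t)); first lra.
  rewrite /Rdiv Rmult_assoc Rinv_l; last lra.
  by rewrite -hroot /E; lra.
move=> eps heps.
have U1 : lX < U 1.
  by move: hup; rewrite /U /Uup /H0_s /Hs /H0_up; case: Req_EM_T => [|_] /=; lra.
(* [V2] serves the final phase; each of its steps gains [gam] over the growth rate [lX] of the
   number of input sequences. *)
have [V2 hV2 hg2] := exponent_approx M Ws X Z Wc y0 r hWc hWci hA2 1 (U 1 - lX)
  ltac:(lra) ltac:(lra).
set g2 := exponent _ _ _ _ _ _ V2 1 in hg2.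
have hgam : 0 < g2 - lX by rewrite -/U in hg2; lra.
have [lc lc0 hP] := Pj_lower_bound M PM1 Ws X Z PXZ1 Wc hPM1 hWs hWsi hPXZ1 hWc hWci hA2 r.
set gam := g2 - lX in hgam.
(* Bound on the price of a final-phase step: likelihood loss in message and noise, the exponent
   [g2], and the rate [E] not accrued. Then [beta] keeps the total below [eps / 4] per step. *)
pose D := (r + 1) * lc + Rabs g2 + Rabs E.
have D0 : 0 <= D.
  by rewrite /D; have := Rabs_pos g2; have := Rabs_pos E; nra.
pose beta := Rmin (1 / 2) (eps / (4 * (D + 1))).
have b0 : 0 < beta by apply: Rmin_glb_lt; [lra|apply: Rdiv_lt_0_compat; lra].
have b1 : beta <= 1 / 2 by apply: Rmin_l.
have b2 : beta * D <= eps / 4.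
  have b3 : beta <= eps / (4 * (D + 1)) by apply: Rmin_r.
  have h1 : beta * (D + 1) <= eps / (4 * (D + 1)) * (D + 1) by apply: Rmult_le_compat_r; lra.
  have h2 : eps / (4 * (D + 1)) * (D + 1) = eps / 4 by field; lra.
  lra.
have bg : 0 < beta * gam by apply: Rmult_lt_0_compat.
(* Half-width of the window for [L / n1]: small against [eps] for the rate, and against [beta * gam]
   so that the final phase outweighs it. *)
pose dl := Rmin (eps / 8) (beta * gam / 16).
have dl0 : 0 < dl by apply: Rmin_glb_lt; lra.
have dl1 : dl <= eps / 8 by apply: Rmin_l.
have dl2 : dl <= beta * gam / 16 by apply: Rmin_r.
have [d0 hd0 hder] := derivable_pt_lim_linear U theta0 dU (dl / 4) hdU ltac:(lra).
pose s := Rmin (d0 / 2) (Rmin (theta0 / 2) ((1 - theta0) / 2)).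
have s0 : 0 < s by apply: Rmin_glb_lt; [lra|apply: Rmin_glb_lt; lra].
have s1 : s <= d0 / 2 by apply: Rmin_l.
have s2 : s <= theta0 / 2 by apply: Rle_trans (Rmin_r _ _) (Rmin_l _ _).
have s3 : s <= (1 - theta0) / 2 by apply: Rle_trans (Rmin_r _ _) (Rmin_r _ _).
have sd : 0 < s * dl by apply: Rmult_lt_0_compat.
have Up : U (theta0 + s) <= U0 + s * dU + s * dl / 4.
  have := hder s; rewrite (Rabs_pos_eq s); last lra.
  move=> /(_ ltac:(lra)); have := Rle_abs (U (theta0 + s) - U theta0 - dU * s).
  by rewrite -/U0; lra.
have Um : U (theta0 - s) <= U0 - s * dU + s * dl / 4.
  have := hder (- s); rewrite Rabs_Ropp (Rabs_pos_eq s); last lra.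
  move=> /(_ ltac:(lra)); have := Rle_abs (U (theta0 + - s) - U theta0 - dU * - s).
  by rewrite -/U0 -/(Rminus theta0 s); lra.
(* [exponent V1] is within [eta] of [U] at [theta0] and below [U] at [theta0 + s] and [theta0 - s];
   so the estimates for [U] transfer without differentiating [exponent V1]. *)
pose eta := Rmin dl (s * dl / 4).
have eta0 : 0 < eta by apply: Rmin_glb_lt; lra.
have eta1 : eta <= dl by apply: Rmin_l.
have eta2 : eta <= s * dl / 4 by apply: Rmin_r.
have [V1 hV1 hu] := exponent_approx M Ws X Z Wc y0 r hWc hWci hA2 theta0 eta ltac:(lra) eta0.
rewrite -/U -/U0 in hu.
have hup' := exponent_le_Uup M Ws X Z Wc y0 r hWc hWci hA2 V1 (theta0 + s) hV1 ltac:(lra).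
have hum' := exponent_le_Uup M Ws X Z Wc y0 r hWc hWci hA2 V1 (theta0 - s) hV1 ltac:(lra).
rewrite -/U in hup' hum'.
have [K hK] := hP V1 V2 theta0 s dU dl hV1 hV2 ltac:(lra) ltac:(lra).
set u := exponent _ _ _ _ _ _ V1 theta0 in hu hK.
set up := exponent _ _ _ _ _ _ V1 (theta0 + s) in hup' hK.
set um := exponent _ _ _ _ _ _ V1 (theta0 - s) in hum' hK.
rewrite -/g2 -/lX in hK.
have [N1 hN1] := split_lengths r beta hr (conj b0 b1).
(* [N2] serves both tails, [N3] the correctly decoded mass, [N4] the final comparison of
   exponents. *)
have [N2 hN2] := eventually_linear (K + s * dl / 2) (s * dl / 4) ltac:(lra).
have [N3 hN3] := eventually_linear (K + gam) (beta * gam / 2) ltac:(lra).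
have [N4 hN4] := eventually_linear (K + Rabs E) (eps / 2) ltac:(lra).
exists (maxn N1 (maxn N2 (maxn N3 N4))) => n.
rewrite !geq_max => /andP[/hN1 h1 /andP[/hN2 h2 /andP[/hN3 h3 /hN4 h4]]].
have [k1 [k2 [n1 [n2 [En Ek hk1 hk2 hn2]]]]] := h1.
have Rn : INR n = INR n1 + INR n2 + 1 by rewrite {1}En S_INR plus_INR.
have p1 := pos_INR n1; have p2 := pos_INR n2.
have hn0 : 0 < INR n by lra.
have bn : beta * INR n <= INR n / 2.
  by have := Rmult_le_compat_r _ _ _ (Rlt_le _ _ hn0) b1; lra.
have hn1 : INR n / 2 - 1 <= INR n1 by lra.
have c1 : INR n1 * (up - u - s * (dU + dl)) <= - K.
  have q : up - u - s * (dU + dl) <= - (s * dl / 2) by lra.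
  by have := Rmult_le_compat_l _ _ _ p1 q; have := Rmult_le_compat_r _ _ _ (Rlt_le _ _ sd) hn1; lra.
have c2 : INR n1 * (um - u + s * (dU - dl)) <= - K.
  have q : um - u + s * (dU - dl) <= - (s * dl / 2) by lra.
  by have := Rmult_le_compat_l _ _ _ p1 q; have := Rmult_le_compat_r _ _ _ (Rlt_le _ _ sd) hn1; lra.
(* By [hroot] the first-phase exponents cancel up to [dl + eta] per step ([q1]); the gain [gam] of
   the final phase beats this. *)
have c3 : (INR n1 + INR n2) * lX - (1 - theta0) * (INR n1 * (dU - dl))
          - (INR n1 * u + INR n2 * g2) <= - K.
  have q1 : lX - (1 - theta0) * (dU - dl) - u <= beta * gam / 8.
    by have := Rmult_le_compat_r dl (1 - theta0) 1 ltac:(lra) ltac:(lra); lra.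
  have q2 : INR n1 * (lX - (1 - theta0) * (dU - dl) - u) <= INR n * (beta * gam / 8).
    apply: Rle_trans (_ : INR n1 * (beta * gam / 8) <= _); first exact: Rmult_le_compat_l.
    by apply: Rmult_le_compat_r; lra.
  have q3 : (beta * INR n - 1) * gam <= INR n2 * gam by apply: Rmult_le_compat_r; lra.
  have q4 : INR n2 * g2 = INR n2 * gam + INR n2 * lX by rewrite /gam; ring.
  have q5 : 0 < beta * gam * INR n by apply: Rmult_lt_0_compat.
  lra.
have := hK k1 k2 n1 n2 hk1 hk2 c1 c2 c3.
rewrite -En -Ek; set B := (X in exp X) => hB.
have hpos : 0 < Pj PM1 Ws PXZ1 Wc (floorR (r * INR n)) n.
  exact: Rlt_le_trans (exp_pos _) hB.
split=> //.
have hln : B <= ln (Pj PM1 Ws PXZ1 Wc (floorR (r * INR n)) n).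
  by rewrite -(ln_exp B); apply: ln_le_compat => //; apply: exp_pos.
(* The first phase costs about [E] per step; each final-phase step deviates from that by at most
   [D], and the first letter by [Rabs E]. *)
have hBn : - B <= INR n * (E + eps).
  have aE := Rle_abs (- E); rewrite Rabs_Ropp in aE.
  have ag := Rle_abs (- g2); rewrite Rabs_Ropp in ag.
  have PE := Rabs_pos E.
  have r1 : INR n1 * (theta0 * (dU + dl) - u) <= INR n1 * (E + eps / 4).
    apply: Rmult_le_compat_l => //; rewrite /E.
    by have := Rmult_le_compat_r dl theta0 1 ltac:(lra) ltac:(lra); lra.
  have r2 : (INR k2 + INR n2) * lc <= INR n2 * ((r + 1) * lc).
    by have := Rmult_le_compat_r lc (INR k2 + INR n2) (r * INR n2 + INR n2) lc0 ltac:(lra); lra.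
  have r3 : INR n2 * D <= INR n * (eps / 4).
    apply: Rle_trans (Rmult_le_compat_r D _ _ D0 (proj2 hn2)) _.
    by have := Rmult_le_compat_l (INR n) _ _ (Rlt_le _ _ hn0) b2; lra.
  have r4 : INR n2 * (- g2) <= INR n2 * Rabs g2 by apply: Rmult_le_compat_l.
  have r5 : INR n2 * (- E) <= INR n2 * Rabs E by apply: Rmult_le_compat_l.
  have r6 : INR n1 * (eps / 4) <= INR n * (eps / 4) by apply: Rmult_le_compat_r; lra.
  have r7 : INR n1 * E = INR n * E + INR n2 * (- E) + - E by rewrite Rn; ring.
  have r8 : INR n2 * D = INR n2 * ((r + 1) * lc) + INR n2 * Rabs g2 + INR n2 * Rabs E.
    by rewrite /D; ring.
  rewrite /B; lra.
apply: (Rmult_le_reg_l (INR n)) => //.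
rewrite -Rmult_assoc (_ : INR n * - / INR n = -1); last by field; lra.
rewrite -/E; lra.
Qed.
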